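(* (Whitehead.) Let $M$ be a monoid, let $X$ be a projective $M$-CW complex and let $k\colon Y\to Z$ be an $M$-equivariant $n$-equivalence of $M$-spaces. Then the induced mapping $k_*\colon[X,Y]_M\to[X,Z]_M$ is a bijection if $\dim X<n$ or $n=\infty$, and a surjection if $\dim X=n<\infty$.
   Context: Let $M$ be a monoid with the discrete topology. An $M$-set $P$ (set with left $M$-action) is projective if every surjective $M$-equivariant map onto $P$ has an $M$-equivariant section; equivalently $P\cong\coprod_{a\in A}Me_a$ with each $e_a\in M$ idempotent. An $M$-space is a topological space with a continuous left action of $M$; $M$-sets are regarded as discrete $M$-spaces. $I=[0,1]$, $B^n$ and $S^{n-1}=\partial B^n$ carry trivial $M$-actions. A projective $M$-CW complex is an $M$-space $X=\varinjlim X_n$ (along inclusions) where $X_0=P_0$ is a projective $M$-set and, for $n\ge1$, $X_n$ is a pushout of $M$-spaces $X_n=X_{n-1}\cup_{P_n\times S^{n-1}}(P_n\times B^n)$ along an $M$-equivariant continuous map $P_n\times S^{n-1}\to X_{n-1}$, with $P_n$ a projective $M$-set. Its dimension is $n$ if $X=X_n$ and $P_n\ne\emptyset$. A continuous map $f\colon X\to Y$ is an $n$-equivalence if $f_*\colon\pi_q(X,x)\to\pi_q(Y,f(x))$ is a bijection for $0\le q<n$ and a surjection for $q=n$, for all base points $x$ (with $\pi_0$ the set of path components). An $\infty$-equivalence is a weak equivalence, i.e. $f_*$ is a bijection for all $q\ge0$. Here $0\le n\le\infty$. An $M$-homotopy between $M$-equivariant continuous maps $f,g\colon X\to Y$ is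 an $M$-equivariant continuous map $H\colon X\times I\to Y$ with $H(x,0)=f(x)$ and $H(x,1)=g(x)$. $[X,Y]_M$ denotes the set of $M$-homotopy classes of $M$-equivariant continuous maps $X\to Y$. *)

(* Defs.v *)
From HB Require Import structures.
From mathcomp Require Import all_boot all_order all_algebra.
From mathcomp Require Import all_classical all_reals.
From mathcomp Require Import topology normedtype.

Set Implicit Arguments.
Unset Strict Implicit.
Unset Printing Implicit Defensive.

Import Order.TTheory GRing.Theory Num.Theory.
Import numFieldNormedType.Exports.

Local Open Scope classical_set_scope.
Local Open Scope ring_scope.

(* For an equivalence relation E on A, [quot_by A E] is A / E as a set of     *)
(* classes. If f : A -> B is compatible with E and F, then [quot_map B F f]   *)
(* is the induced map A / E -> B / F, sending the class of a to that of f a.  *)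
Definition quot_by (T : Type) (A : set T) (E : T -> T -> Prop) : set (set T) :=
  [set [set b | A b /\ E a b] | a in A].

Definition quot_map (T U : Type) (B : set U) (F : U -> U -> Prop) (f : T -> U) :
    set T -> set U :=
  fun c => [set b | B b /\ exists2 a, c a & F (f a) b].

(* Elements of {0, 1, 2, ...} together with infinity are encoded in           *)
(* [option nat], where [None] is infinity.                                    *)
Definition ltn_ext (q : nat) (n : option nat) : Prop :=
  if n is Some m then (q < m)%N else True.

HB.mixin Record hasMonoidAction (M : monoidType) X := {
  mact : M -> X -> X;
  mact1 : forall x, mact 1%g x = x;
  mactM : forall m1 m2 x, mact (m1 * m2)%g x = mact m1 (mact m2 x)
}.

#[short(type="msetType")]
HB.structure Definition MSet (M : monoidType) :=
  {X of hasMonoidAction M X & Choice X}.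

HB.mixin Record hasContinuousAction (M : monoidType) X
    of MSet M X & Topological X := {
  mact_continuous :
    continuous (fun mx : discrete_topology M * X => mact (mx.1 : M) mx.2)
}.

#[short(type="mspaceType")]
HB.structure Definition MSpace (M : monoidType) :=
  {X of MSet M X & Topological X & hasContinuousAction M X}.

Lemma continuous_discrete_action (M : choiceType) (X Y : topologicalType)
    (f : M -> X -> Y) :
  (forall m, continuous (f m)) ->
  continuous (fun mx : discrete_topology M * X => f (mx.1 : M) mx.2).
Proof.
move=> cf [m x] V /= /(cf m x) nV.
exists ([set m], f m @^-1` V); first by split => //; exact: discrete_set1.
by move=> [m' x'] [/= -> ].
Qed.

Lemma mact_continuous1 (M : monoidType) (X : mspaceType M) (m : M) :
  continuous (@mact M X m).
Proof.
move=> x V /(@mact_continuous M X (m, x)) [[A B] /= [nA nB] AB].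
apply: filterS nB => y By; apply: (AB (m, y)).
by split => //; exact: nbhs_singleton.
Qed.

Section Equivariance.
Variable M : monoidType.

Definition equivariant (X Y : msetType M) (f : X -> Y) : Prop :=
  forall m x, f (mact m x) = mact m (f x).

Definition projective_mset (P : msetType M) : Prop :=
  forall (S : msetType M) (f : S -> P),
    equivariant f -> (forall p, exists s, f s = p) ->
    exists2 s : P -> S, equivariant s & forall p, f (s p) = p.

Definition mmaps (X Y : mspaceType M) : set (X -> Y) :=
  [set f | continuous f /\ equivariant f].

Definition miso (X Y : mspaceType M) (f : X -> Y) : Prop :=
  mmaps f /\ exists2 g : Y -> X, mmaps g & cancel f g /\ cancel g f.

(*       f                *)
(*   A ----> B            *)
(*  g|       |i           *)
(*   v   j   v            *)
(*   C ----> D            *)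
Definition is_mpushout (A B C D : mspaceType M)
    (f : A -> B) (g : A -> C) (i : B -> D) (j : C -> D) : Prop :=
  [/\ mmaps i, mmaps j, (forall a, i (f a) = j (g a)) &
    forall (T : mspaceType M) (u : B -> T) (v : C -> T),
      mmaps u -> mmaps v -> (forall a, u (f a) = v (g a)) ->
      exists! h : D -> T, [/\ mmaps h, (forall b, h (i b) = u b)
                            & (forall c, h (j c) = v c)]].

Definition is_mcolimit (A : nat -> mspaceType M)
    (s : forall n, A n -> A n.+1) (X : mspaceType M)
    (i : forall n, A n -> X) : Prop :=
  [/\ (forall n, mmaps (i n)), (forall n a, i n.+1 (s n a) = i n a) &
    forall (T : mspaceType M) (u : forall n, A n -> T),
      (forall n, mmaps (u n)) -> (forall n a, u n.+1 (s n a) = u n a) ->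
      exists! h : X -> T, mmaps h /\ forall n a, h (i n a) = u n a].

End Equivariance.

Section Discrete.
Variables (M : monoidType) (P : msetType M).

HB.instance Definition _ := hasMonoidAction.Build M (discrete_topology P)
  (@mact1 M P) (@mactM M P).

Lemma discrete_mact_continuous :
  continuous (fun mx : discrete_topology M * discrete_topology P =>
                mact (mx.1 : M) mx.2 : discrete_topology P).
Proof.
apply: (continuous_discrete_action
  (f := fun (m : M) (x : discrete_topology P) => mact m x)).
by move=> m x V /principal_filterP Vx; apply/principal_filterP.
Qed.

HB.instance Definition _ := hasContinuousAction.Build M (discrete_topology P)
  discrete_mact_continuous.
End Discrete.

Section ProductAction.
Variables (M : monoidType) (X Y : msetType M).

Definition prod_mact (m : M) (p : X * Y) : X * Y := (mact m p.1, mact m p.2).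

Lemma prod_mact1 p : prod_mact 1%g p = p.
Proof. by case: p => x y; rewrite /prod_mact !mact1. Qed.

Lemma prod_mactM m1 m2 p :
  prod_mact (m1 * m2)%g p = prod_mact m1 (prod_mact m2 p).
Proof. by rewrite /prod_mact !mactM. Qed.

HB.instance Definition _ := hasMonoidAction.Build M (X * Y)%type
  prod_mact1 prod_mactM.
End ProductAction.

Section ProductSpace.
Variables (M : monoidType) (X Y : mspaceType M).

Lemma prod_mact_continuous :
  continuous (fun mx : discrete_topology M * (X * Y) =>
                mact (mx.1 : M) mx.2 : X * Y).
Proof.
apply: (continuous_discrete_action
  (f := fun (m : M) (p : X * Y) => mact m p)) => m [x y].
move=> V [[A B] /= [nA nB] AB]; exists (mact m @^-1` A, mact m @^-1` B) => /=.
  by split; exact: mact_continuous1.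
by move=> [x' y'] [/= Ax By]; exact: AB.
Qed.

HB.instance Definition _ := hasContinuousAction.Build M (X * Y)%type
  prod_mact_continuous.
End ProductSpace.

Definition trivial_mspace (T : Type) : Type := T.

Section Trivial.
Variables (M : monoidType) (T : topologicalType).

HB.instance Definition _ := Topological.copy (trivial_mspace T) T.

HB.instance Definition _ := hasMonoidAction.Build M (trivial_mspace T)
  (mact := fun=> id) (fun=> erefl) (fun _ _ _ => erefl).

Lemma trivial_mact_continuous :
  continuous (fun mx : discrete_topology M * trivial_mspace T =>
                mact (mx.1 : M) mx.2 : trivial_mspace T).
Proof.
move=> [m x] V nV; exists (setT, V) => /=; last by case=> ? ? [].
by split => //; exact: filterT.
Qed.

HB.instance Definition _ := hasContinuousAction.Build M (trivial_mspace T)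
  trivial_mact_continuous.
End Trivial.

Section EuclideanSpaces.
Variable R : realType.

Definition unit_interval : Type := `[0, 1]%classic : set R.

HB.instance Definition _ := Topological.copy unit_interval
  (set_type (`[0, 1]%classic : set R)).

Lemma in_unit_interval0 : (0 : R) \in `[0, 1]%classic.
Proof. by apply/mem_set; rewrite /= in_itv /= lexx ler01. Qed.

Lemma in_unit_interval1 : (1 : R) \in `[0, 1]%classic.
Proof. by apply/mem_set; rewrite /= in_itv /= lexx ler01. Qed.

Definition I0 : unit_interval := exist _ 0 in_unit_interval0.
Definition I1 : unit_interval := exist _ 1 in_unit_interval1.

Definition cube_set (q : nat) : set 'rV[R]_q :=
  [set v | forall i, 0 <= v ord0 i <= 1].

Definition cube (q : nat) : Type := @cube_set q.

HB.instance Definition _ q := Topological.copy (cube q) (set_type (@cube_set q)).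

Definition cube_boundary (q : nat) : set (cube q) :=
  [set v : cube q | exists i, sval v ord0 i = 0 \/ sval v ord0 i = 1].

(* The norm of the library on row vectors is the sup norm, whence the sums of *)
(* squares.                                                                   *)
Definition disk_set (n : nat) : set 'rV[R]_n :=
  [set v | \sum_i v ord0 i ^+ 2 <= 1].

Definition disk (n : nat) : Type := @disk_set n.

HB.instance Definition _ n := Topological.copy (disk n) (set_type (@disk_set n)).

(* [sphere n] is the boundary of [disk n], i.e. the (n-1)-sphere.             *)
Definition sphere_set (n : nat) : set 'rV[R]_n :=
  [set v | \sum_i v ord0 i ^+ 2 = 1].

Definition sphere (n : nat) : Type := @sphere_set n.

HB.instance Definition _ n :=
  Topological.copy (sphere n) (set_type (@sphere_set n)).

Lemma sphere_sub_disk n (v : sphere n) : sval v \in @disk_set n.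
Proof.
by case: v => v /= /set_mem v1; apply/mem_set; rewrite /disk_set /= v1.
Qed.

Definition sphere_disk n (v : sphere n) : disk n :=
  exist _ (sval v) (sphere_sub_disk v).

End EuclideanSpaces.

Section HomotopyGroups.
Variable R : realType.
Local Notation I := (unit_interval R).

Definition joined_by_path (X : topologicalType) (x y : X) : Prop :=
  exists p : I -> X, [/\ continuous p, p (I0 R) = x & p (I1 R) = y].

Definition pi0 (X : topologicalType) : set (set X) :=
  quot_by setT (@joined_by_path X).

Arguments pi0 : clear implicits.

Definition pi0_map (X Y : topologicalType) (f : X -> Y) : set X -> set Y :=
  quot_map setT (@joined_by_path Y) f.

Definition spheroid (q : nat) (X : topologicalType) (x : X) :
    set (cube R q -> X) :=
  [set a | continuous a /\ forall v, cube_boundary v -> a v = x].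

Definition spheroid_homotopic (q : nat) (X : topologicalType) (x : X)
    (a b : cube R q -> X) : Prop :=
  exists H : cube R q * I -> X,
    [/\ continuous H,
        (forall v, H (v, I0 R) = a v),
        (forall v, H (v, I1 R) = b v) &
        (forall v t, cube_boundary v -> H (v, t) = x)].

Definition pi_ (q : nat) (X : topologicalType) (x : X) :
    set (set (cube R q -> X)) :=
  quot_by (@spheroid q X x) (@spheroid_homotopic q X x).

Arguments pi_ : clear implicits.
Arguments spheroid : clear implicits.

Definition pi_map (q : nat) (X Y : topologicalType) (x : X) (f : X -> Y) :
    set (cube R q -> X) -> set (cube R q -> Y) :=
  quot_map (spheroid q Y (f x)) (@spheroid_homotopic q Y (f x)) (fun a => f \o a).

(* The set of path components is treated apart because it does not depend on  *)
(* a base point: when X is empty, the conditions at all the base points of X  *)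
(* are void, but the one on path components is not.                           *)
Definition n_equivalence (n : option nat) (X Y : topologicalType)
    (f : X -> Y) : Prop :=
  [/\ continuous f,
      ltn_ext 0 n -> set_bij (pi0 X) (pi0 Y) (pi0_map f),
      n = Some 0%N -> set_surj (pi0 X) (pi0 Y) (pi0_map f) &
      forall (q : nat) (x : X), (0 < q)%N ->
        (ltn_ext q n -> set_bij (pi_ q X x) (pi_ q Y (f x)) (pi_map x f)) /\
        (n = Some q -> set_surj (pi_ q X x) (pi_ q Y (f x)) (pi_map x f))].

End HomotopyGroups.

Arguments pi0 R X : clear implicits.
Arguments spheroid R q X x : clear implicits.
Arguments pi_ R q X x : clear implicits.
Arguments pi_map R q {X Y} x f.

Section MHomotopy.
Variables (R : realType) (M : monoidType).

Definition mhomotopic (X Y : mspaceType M) (f g : X -> Y) : Prop :=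
  exists H : X * trivial_mspace (unit_interval R) -> Y,
    [/\ mmaps H, (forall x, H (x, I0 R) = f x) & (forall x, H (x, I1 R) = g x)].

Definition mclasses (X Y : mspaceType M) : set (set (X -> Y)) :=
  quot_by (@mmaps M X Y) (@mhomotopic X Y).

Definition mclasses_map (X Y Z : mspaceType M) (k : Y -> Z) :
    set (X -> Y) -> set (X -> Z) :=
  quot_map (@mmaps M X Z) (@mhomotopic X Z) (fun f => k \o f).

End MHomotopy.

Arguments mclasses R {M} X Y.
Arguments mclasses_map R {M} X {Y Z} k.

Section CW.
Variables (R : realType) (M : monoidType).

Definition cell_boundary (P : msetType M) (n : nat)
    (pv : discrete_topology P * trivial_mspace (sphere R n)) :
    discrete_topology P * trivial_mspace (disk R n) :=
  (pv.1, sphere_disk pv.2).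

(* X_0 is P_0, X_{n+1} is the pushout and X is the colimit up to isomorphism  *)
(* of M-spaces; that the maps X_n -> X_{n+1} -> X are inclusions follows from *)
(* the universal properties.                                                  *)
Record projective_cw (X : mspaceType M) := ProjectiveCW {
  cw_cells : nat -> msetType M;
  cw_cells_projective : forall n, projective_mset (cw_cells n);
  cw_skel : nat -> mspaceType M;
  cw_incl : forall n, cw_skel n -> cw_skel n.+1;
  cw_skel0 : discrete_topology (cw_cells 0%N) -> cw_skel 0%N;
  cw_skel0_iso : miso cw_skel0;
  cw_attach : forall n,
    discrete_topology (cw_cells n.+1) * trivial_mspace (sphere R n.+1) ->
    cw_skel n;
  cw_attach_mmap : forall n, mmaps (@cw_attach n);
  cw_char : forall n,
    discrete_topology (cw_cells n.+1) * trivial_mspace (disk R n.+1) ->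
    cw_skel n.+1;
  cw_pushout : forall n,
    is_mpushout (@cw_attach n) (@cell_boundary (cw_cells n.+1) n.+1)
                (@cw_incl n) (@cw_char n);
  cw_inj : forall n, cw_skel n -> X;
  cw_colimit : is_mcolimit cw_incl cw_inj
}.

(* [X = X_d] means that the canonical map X_d -> X is an isomorphism.         *)
Definition cw_dim (X : mspaceType M) (C : projective_cw X) (d : nat) : Prop :=
  miso (@cw_inj X C d) /\ inhabited (cw_cells C d).

End CW.

(* Main.v *)
Require Import Defs.
From HB Require Import structures.
From mathcomp Require Import all_boot all_order all_algebra.
From mathcomp Require Import all_classical all_reals.
From mathcomp Require Import topology normedtype realfun.
From mathcomp Require Import lra.

Set Implicit Arguments.
Unset Strict Implicit.
Unset Printing Implicit Defensive.

Import Order.TTheory GRing.Theory Num.Theory.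
Import numFieldNormedType.Exports.

Local Open Scope classical_set_scope.
Local Open Scope ring_scope.

(** Replace [k] by the fibration [mp_start : mapping_path -> Z], whose points
    are pairs of a point [y] of [Y] and a path in [Z] that ends at [k y], and
    which sends such a pair to the start of the path. A map from [X] to
    [mapping_path] over [f : X -> Z] is exactly a map [g : X -> Y] together with
    a homotopy from [f] to [k \o g]. The universal properties of pushouts and of
    the colimit build such a lift one skeleton at a time ([cw_lifting_dim],
    [cw_lifting_infinite]), provided that [mp_start] has the lifting property
    with respect to the inclusions of [P * sphere] into [P * disk]. Since [P] is
    projective, it is a retract of the free M-set [M * P]; hence lifts chosen
    cell by cell, without any equivariance, can be made equivariant
    ([projective_extension]). The problem becomes a nonequivariant one on a
    single disk.

    That problem is stated for the unit ball of any normed space and solved for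
    the cubes [-1, 1]^q, the unit balls of the sup norm. Whether a lift exists
    depends only on the homotopy class of the problem
    ([lift_solvable_homotopy]). Up to homotopy, the attaching map [u] on the
    sphere is constant on all faces but one, and the given map to [Z] says that
    the remaining face is a spheroid of [Y] killed by [k]; injectivity of [k] on
    pi_(q-1) extends [u] over the ball ([sphere_extension]). Once [u] extends it
    can be contracted to a constant ([lifting_by_contraction]); the given map to
    [Z] is then a spheroid, and surjectivity of [k] on pi_q provides the lift. A
    radial homeomorphism transports the result to Euclidean disks.

    Surjectivity of [k_*] is the existence of these lifts in all dimensions of
    cells of [X]. Injectivity is the same statement for another map: the map
    [path_incl] from the paths of [Y] to the paths of [Z] whose two endpoints
    are lifted to [Y]. A homotopy from [k \o f0] to [k \o f1] is a map from [X]
    to the target of [path_incl], and compressing it into the source gives a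
    homotopy from [f0] to [f1]. The lifting property of [path_incl] on a ball is
    that of [k] on the cylinder over this ball ([path_incl_lifting]), one
    dimension higher, which is why bijectivity requires [dim X < n]. *)

(** * Continuity at a point *)

Section ContinuityAtAPoint.

Lemma at_cst (T U : topologicalType) (p : T) (c : U) :
  continuous_at p (fun=> c).
Proof. exact: cvg_cst. Qed.

Lemma at_id (T : topologicalType) (p : T) : continuous_at p (fun x => x).
Proof. exact: cvg_id. Qed.

Lemma at_comp (T U W : topologicalType) (g : T -> U) (f : U -> W) (p : T) :
  continuous_at p g -> continuous_at (g p) f ->
  continuous_at p (fun x => f (g x)).
Proof. exact: continuous_comp. Qed.

Lemma at_pair (T U W : topologicalType) (f : T -> U) (g : T -> W) (p : T) :
  continuous_at p f -> continuous_at p g ->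
  continuous_at p (fun x => (f x, g x)).
Proof. exact: cvg_pair. Qed.

Lemma at_fst (T U W : topologicalType) (f : T -> U * W) (p : T) :
  continuous_at p f -> continuous_at p (fun x => (f x).1).
Proof. by move=> cf; apply: (at_comp cf); exact: cvg_fst. Qed.

Lemma at_snd (T U W : topologicalType) (f : T -> U * W) (p : T) :
  continuous_at p f -> continuous_at p (fun x => (f x).2).
Proof. by move=> cf; apply: (at_comp cf); exact: cvg_snd. Qed.

Lemma at_add (R : realType) (T : topologicalType) (V : normedModType R)
    (f g : T -> V) (p : T) :
  continuous_at p f -> continuous_at p g ->
  continuous_at p (fun x => f x + g x).
Proof. exact: cvgD. Qed.

Lemma at_opp (R : realType) (T : topologicalType) (V : normedModType R)
    (f : T -> V) (p : T) :
  continuous_at p f -> continuous_at p (fun x => - f x).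
Proof. exact: cvgN. Qed.

Lemma at_scale (R : realType) (T : topologicalType) (V : normedModType R)
    (f : T -> R) (g : T -> V) (p : T) :
  continuous_at p f -> continuous_at p g ->
  continuous_at p (fun x => f x *: g x).
Proof. exact: cvgZ. Qed.

Lemma at_mul (R : realType) (T : topologicalType) (f g : T -> R) (p : T) :
  continuous_at p f -> continuous_at p g ->
  continuous_at p (fun x => f x * g x).
Proof. exact: cvgM. Qed.

Lemma at_inv (R : realType) (T : topologicalType) (f : T -> R) (p : T) :
  continuous_at p f -> f p != 0 -> continuous_at p (fun x => (f x)^-1).
Proof. by move=> cf f0; exact: cvgV. Qed.

Lemma at_norm (R : realType) (T : topologicalType) (V : normedModType R)
    (f : T -> V) (p : T) :
  continuous_at p f -> continuous_at p (fun x => `|f x|).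
Proof. exact: cvg_norm. Qed.

Lemma at_max (R : realType) (T : topologicalType) (f g : T -> R) (p : T) :
  continuous_at p f -> continuous_at p g ->
  continuous_at p (fun x => Num.max (f x) (g x)).
Proof. exact: continuous_max. Qed.

Lemma at_min (R : realType) (T : topologicalType) (f g : T -> R) (p : T) :
  continuous_at p f -> continuous_at p g ->
  continuous_at p (fun x => Num.min (f x) (g x)).
Proof. exact: continuous_min. Qed.

(** Pasting along the zero set of a continuous real function: only the branch
    that is active near [p] has to be continuous at [p]. *)
Lemma at_if (R : realType) (T U : topologicalType) (c : T -> R)
    (f g : T -> U) (p : T) :
  continuous_at p c ->
  (c p <= 0 -> continuous_at p f) -> (0 <= c p -> continuous_at p g) ->
  (c p = 0 -> f p = g p) ->
  continuous_at p (fun x => if c x <= 0 then f x else g x).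
Proof.
move=> cc cf cg fg V /=.
case: (ltgtP (c p) 0) => cp nV.
- have h1 : \forall x \near p, c x < 0 by exact: cvgr_lt cc _ cp.
  have h2 : \forall x \near p, V (f x) by exact: cf (ltW cp) _ nV.
  by apply: filterS2 h1 h2 => x /ltW /= ->.
- have h1 : \forall x \near p, 0 < c x by exact: cvgr_gt cc _ cp.
  have h2 : \forall x \near p, V (g x) by exact: cg (ltW cp) _ nV.
  by apply: filterS2 h1 h2 => x /=; rewrite ltNge => /negPf ->.
- have c0 : c p <= 0 by rewrite cp.
  have c0' : 0 <= c p by rewrite cp.
  have nV' := nV; rewrite fg // in nV'.
  have h1 : \forall x \near p, V (f x) by exact: cf c0 _ nV.
  have h2 : \forall x \near p, V (g x) by exact: cg c0' _ nV'.
  by apply: filterS2 h1 h2 => x /= fV gV; case: ifP.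
Qed.

Lemma at_near (T U : topologicalType) (f g : T -> U) (p : T) :
  {near p, f =1 g} -> continuous_at p g -> continuous_at p f.
Proof.
move=> fg cg V; rewrite (nbhs_singleton fg) => nV.
have h : \forall x \near p, V (g x) by exact: cg nV.
suff : \forall x \near p, V (f x) by [].
by apply: filterS2 fg h => x /= ->.
Qed.

Lemma at_nth (R : realType) (T : topologicalType) q (f : T -> 'rV[R]_q) i
    (p : T) :
  continuous_at p f -> continuous_at p (fun x => f x ord0 i).
Proof.
move=> cf; apply: (@at_comp _ _ _ f (fun N : 'rV[R]_q => N ord0 i)) => //.
exact: coord_continuous.
Qed.

Lemma at_row (R : realType) (T : topologicalType) q (f : T -> 'I_q -> R)
    (p : T) :
  (forall i, continuous_at p (fun x => f x i)) ->
  continuous_at p (fun x => \row_i f x i : 'rV[R]_q).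
Proof.
move=> cf V [W nW WV]; have : \forall x \near p, forall i, W ord0 i (f x i).
  apply: filter_forall => i; apply: cf.
  by have := nW ord0 i; rewrite mxE.
apply: filterS => x Wx; apply: WV => i j.
by rewrite ord1 mxE.
Qed.

Lemma at_sum (R : realType) (T : topologicalType) q (f : T -> 'I_q -> R)
    (p : T) :
  (forall i, continuous_at p (fun x => f x i)) ->
  continuous_at p (fun x => \sum_i f x i).
Proof.
move=> cf; elim: (index_enum _) => [|i s IH].
  rewrite (_ : (fun x => _) = fun=> 0); first exact: at_cst.
  by apply/funext => x; rewrite big_nil.
rewrite (_ : (fun x => _) = fun x => f x i + \sum_(j <- s) f x j).
  exact: at_add.
by apply/funext => x; rewrite big_cons.
Qed.

End ContinuityAtAPoint.

(** Splits a continuity goal along the outermost operation of the function,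
    and leaves the parts that are not continuous by construction. *)
Ltac cont :=
  lazymatch goal with
  | |- continuous_at _ (fun=> ?c) => exact: at_cst
  | |- continuous_at _ (fun x => x) => exact: at_id
  | |- continuous_at _ (fun x => (@?f x, @?g x)) =>
      apply: (@at_pair _ _ _ f g); cont
  | |- continuous_at _ (fun x => (@?f x).1) => apply: (@at_fst _ _ _ f); cont
  | |- continuous_at _ (fun x => (@?f x).2) => apply: (@at_snd _ _ _ f); cont
  | |- continuous_at _ (fun x => @?f x + @?g x) =>
      apply: (@at_add _ _ _ f g); cont
  | |- continuous_at _ (fun x => - @?f x) => apply: (@at_opp _ _ _ f); cont
  | |- continuous_at _ (fun x => @?f x *: @?g x) =>
      apply: (@at_scale _ _ _ f g); cont
  | |- continuous_at _ (fun x => @?f x * @?g x) =>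
      apply: (@at_mul _ _ f g); cont
  | |- continuous_at _ (fun x => (@?f x)^-1) => apply: (@at_inv _ _ f); cont
  | |- continuous_at _ (fun x => `|@?f x|) => apply: (@at_norm _ _ _ f); cont
  | |- continuous_at _ (fun x => Order.max (@?f x) (@?g x)) =>
      apply: (@at_max _ _ f g); cont
  | |- continuous_at _ (fun x => Order.min (@?f x) (@?g x)) =>
      apply: (@at_min _ _ f g); cont
  | |- continuous_at _ (fun x => fun_of_matrix (@?f x) ord0 ?i) =>
      apply: (@at_nth _ _ _ f i); cont
  | |- continuous_at _ (fun x => if _ then _ else _) =>
      apply: at_if; cont
  | |- continuous_at _ (fun x => ?f (@?g x)) =>
      try (apply: (@at_comp _ _ _ g f); cont)
  | H : continuous ?f |- continuous_at _ ?f => exact: H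
  | |- _ => idtac
  end.

(** * Retractions onto the unit interval and the unit ball *)

Section Retractions.
Variables (R : realType) (V : normedModType R).

Definition clamp (t : R) : R := Num.max 0 (Num.min 1 t).

Lemma clamp_itv (t : R) : 0 <= clamp t <= 1.
Proof. by rewrite /clamp le_max lexx ge_max ler01 ge_min lexx. Qed.

Lemma clamp_id (t : R) : 0 <= t <= 1 -> clamp t = t.
Proof. by case/andP=> t0 t1; rewrite /clamp (min_idPr t1) (max_idPr t0). Qed.

Lemma clampK (t : R) : clamp (clamp t) = clamp t.
Proof. exact/clamp_id/clamp_itv. Qed.

Lemma clamp0 : clamp 0 = 0.
Proof. by rewrite clamp_id // lexx ler01. Qed.

Lemma clamp1 : clamp 1 = 1.
Proof. by rewrite clamp_id // lexx ler01. Qed.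

Lemma clamp_continuous : continuous clamp.
Proof. by move=> t; rewrite /clamp; cont. Qed.

Definition ball_proj (x : V) : V := (Num.max 1 `|x|)^-1 *: x.

Lemma ball_proj_continuous : continuous ball_proj.
Proof.
move=> x; rewrite /ball_proj; cont.
by rewrite gt_eqF // lt_max ltr01.
Qed.

Lemma ball_proj_id x : `|x| <= 1 -> ball_proj x = x.
Proof. by move=> x1; rewrite /ball_proj (max_idPl x1) invr1 scale1r. Qed.

Lemma norm_normalize (x : V) : x != 0 -> `| (`|x|^-1 *: x) | = 1.
Proof.
by move=> x0; rewrite normrZ normfV normr_id mulVf // normr_eq0.
Qed.

Lemma ball_proj_out x : 1 <= `|x| -> ball_proj x = `|x|^-1 *: x.
Proof. by move=> x1; rewrite /ball_proj (max_idPr x1). Qed.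

Lemma norm_ball_proj_out x : 1 <= `|x| -> `|ball_proj x| = 1.
Proof.
move=> x1; rewrite ball_proj_out // norm_normalize // -normr_gt0.
exact: lt_le_trans x1.
Qed.

Lemma norm_ball_proj x : `|ball_proj x| <= 1.
Proof.
have [x1|/ltW x1] := leP `|x| 1; first by rewrite ball_proj_id.
by rewrite norm_ball_proj_out.
Qed.

Lemma norm1_neq0 (x : V) : `|x| = 1 -> x != 0.
Proof. by move=> x1; rewrite -normr_gt0 x1. Qed.

End Retractions.

(** * Lifting problems on the unit ball of a normed space *)

Section BallProblems.
Variables (R : realType) (V : normedModType R) (Y Z : topologicalType).
Variable k : Y -> Z.

(** Maps on the ball are represented by maps on all of [V], and maps on the
    sphere by maps on [V] that are continuous away from the origin: every
    continuous map on the ball or on the sphere extends in this way along the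
    radial retraction, and the formulas below stay free of subtypes. Only the
    values on the ball, respectively on the sphere, and at times in [0, 1]
    matter.
    The data are a map [u] from the sphere to [Y], a map [w] from the ball to
    [Z] and a homotopy [h] on the sphere from [w] to [k \o u]. *)
Definition lift_problem (u : V -> Y) (h : V * R -> Z) (w : V -> Z) : Prop :=
  [/\ (forall x : V, x != 0 -> continuous_at x u),
      (forall (x : V) (t : R), x != 0 -> continuous_at (x, t) h),
      continuous w,
      (forall x : V, `|x| = 1 -> h (x, 0) = w x) &
      (forall x : V, `|x| = 1 -> h (x, 1) = k (u x))].

(** An extension [u'] of [u] to the ball, with a homotopy from [w] to
    [k \o u'] that extends [h]. *)
Definition lift_solvable (u : V -> Y) (h : V * R -> Z) (w : V -> Z) : Prop :=
  exists (u' : V -> Y) (h' : V * R -> Z),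
    [/\ continuous u' /\ continuous h',
        (forall x : V, `|x| = 1 -> u' x = u x),
        (forall (x : V) (t : R),
           `|x| = 1 -> 0 <= t <= 1 -> h' (x, t) = h (x, t)),
        (forall x : V, `|x| <= 1 -> h' (x, 0) = w x) &
        (forall x : V, `|x| <= 1 -> h' (x, 1) = k (u' x))].

(** Let [b, K] solve the problem at time 1. The ball of radius 1/2 is given a
    rescaled copy of this solution, and the collar between the radii 1/2 and 1
    is filled with the homotopy of problems, run from time 1 at the radius 1/2
    to time 0 at the radius 1. *)
Lemma lift_solvable_homotopy (u : V * R -> Y) (h : (V * R) * R -> Z)
    (w : V * R -> Z) :
  (forall (x : V) (t : R), x != 0 -> continuous_at (x, t) u) ->
  (forall (x : V) (s t : R), x != 0 -> continuous_at ((x, s), t) h) ->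
  continuous w ->
  (forall (x : V) (t : R), `|x| = 1 -> 0 <= t <= 1 -> h (x, 0, t) = w (x, t)) ->
  (forall (x : V) (t : R),
     `|x| = 1 -> 0 <= t <= 1 -> h (x, 1, t) = k (u (x, t))) ->
  lift_solvable (fun x => u (x, 1)) (fun p => h (p, 1)) (fun x => w (x, 1)) ->
  lift_solvable (fun x => u (x, 0)) (fun p => h (p, 0)) (fun x => w (x, 0)).
Proof.
move=> cu ch cw h0 h1 [b [K [[cb cK] bu Kh K0 K1]]].
(* [n x] is the radial projection of the collar to the sphere and the dilation
   by 2 on the inner ball; [ts x] is the time of the problem that is used at
   [x]. *)
pose a (x : V) := Num.max `|x| 2^-1.
pose ts x := (a x)^-1 - 1.
pose n (x : V) := (a x)^-1 *: x.
have a_gt0 x : 0 < a x by rewrite lt_max invr_gt0 ltr0n orbT.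
have ca : continuous a by move=> x; rewrite /a; cont.
have cts : continuous ts by move=> x; rewrite /ts; cont; rewrite gt_eqF.
have cn : continuous n by move=> x; rewrite /n; cont; rewrite gt_eqF.
have a_out x : 2^-1 <= `|x| -> a x = `|x| by move=> xl; apply/max_idPl.
have a_in x : `|x| <= 2^-1 -> a x = 2^-1 by move=> xl; apply/max_idPr.
have ts_in x : `|x| <= 2^-1 -> ts x = 1.
  by move=> xl; rewrite /ts a_in // invrK; lra.
have ts_itv x : `|x| <= 1 -> 0 <= ts x <= 1.
  move=> x1; have al : 2^-1 <= a x by rewrite le_max lexx orbT.
  have a1 : a x <= 1 by rewrite ge_max x1 /=; lra.
  have : 1 <= (a x)^-1 by rewrite -[leLHS]invr1 lef_pV2 ?posrE.
  have : (a x)^-1 <= 2.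
    by rewrite -[leRHS]invrK lef_pV2 ?posrE ?invr_gt0 ?ltr0n.
  by rewrite /ts; lra.
have n_out x : 2^-1 <= `|x| -> x != 0 /\ `|n x| = 1.
  move=> xl; have x0 : x != 0 by rewrite -normr_gt0; lra.
  by split => //; rewrite /n a_out // norm_normalize.
have n_in x : `|x| <= 2^-1 -> `|n x| <= 1.
  move=> xl; rewrite /n a_in // invrK normrZ ger0_norm ?ler0n //; lra.
pose U x := if `|x| - 2^-1 <= 0 then b (n x) else u (n x, ts x).
(* At [x], first move from [w (x, 0)] to [w (n x, ts x)] by pushing [x] outwards
   along its ray while the time of the problem grows, then follow [K] or the
   homotopy [h] at time [ts x]. The speed is chosen so that the total length
   [1 + ts x] is covered in unit time; it is 1 on the sphere, where no time is
   spent on the first part. *)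
pose H' (p : V * R) := let: (x, t) := p in
  let s := t * (a x)^-1 in
  if s - ts x <= 0 then w ((1 + s) *: x, s) else
  if `|x| - 2^-1 <= 0 then K (n x, s - ts x) else h (n x, s - ts x, ts x).
exists (U \o @ball_proj R V), (fun p => H' (ball_proj p.1, clamp p.2)).
have H'E (x : V) t : H' (x, t) = let s := t * (a x)^-1 in
  if s - ts x <= 0 then w ((1 + s) *: x, s) else
  if `|x| - 2^-1 <= 0 then K (n x, s - ts x) else h (n x, s - ts x, ts x) by [].
split.
- split.
  + move=> x; apply: at_comp; first exact: ball_proj_continuous.
    move: (ball_proj x) (norm_ball_proj x) => {}x x1.
    rewrite /U; cont => xl.
    * by cont.
    * have [n0 _] : n x != 0 /\ `|n x| = 1.
        by have [|_ /[dup] /norm1_neq0] := n_out x; first lra.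
      by cont; exact: cu.
    * have xl' : `|x| = 2^-1 by lra.
      rewrite ts_in ?xl' // bu //.
      by have [|_ ->] := n_out x; first lra.
  + move=> [x t]; apply: at_comp.
      by cont; [exact: ball_proj_continuous | exact: clamp_continuous].
    move: (ball_proj x) (norm_ball_proj x) (clamp t) (clamp_itv t).
    move=> {}x x1 {}t t01; rewrite /H' /=.
    rewrite (_ : (fun p => _) = fun p : V * R =>
      if p.2 * (a p.1)^-1 - ts p.1 <= 0
      then w ((1 + p.2 * (a p.1)^-1) *: p.1, p.2 * (a p.1)^-1) else
      if `|p.1| - 2^-1 <= 0 then K (n p.1, p.2 * (a p.1)^-1 - ts p.1)
      else h (n p.1, p.2 * (a p.1)^-1 - ts p.1, ts p.1)); last first.
      by apply/funext => -[].
    have ax0 : a x != 0 by rewrite gt_eqF.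
    cont => //= c0.
    * by cont.
    * cont => //= [_|xl|xl]; first by cont.
      -- have [|_ /norm1_neq0 n0] := n_out x; first lra.
         by cont => //; exact: ch.
      -- have xl' : `|x| = 2^-1 by lra.
         have [|_ n1] := n_out x; first lra.
         rewrite ts_in ?xl' // in c0 *; rewrite Kh // c0 /=.
         by rewrite a_in ?xl' // invrK; lra.
    * have -> : t / a x = ts x by lra.
      rewrite subrr; case: ifPn => xl.
        have xl' : `|x| <= 2^-1 by lra.
        by rewrite ts_in // K0 ?n_in // /n a_in // invrK.
      have [|_ n1] := n_out x; first lra.
      rewrite h0 ?ts_itv //; congr (w (_, _)).
      by rewrite /ts /n; congr (_ *: _); lra.
- move=> x x1 /=; rewrite ball_proj_id ?x1 // /U.
  case: ifPn => [|_]; first by rewrite x1 => xl; exfalso; lra.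
  by rewrite /n /ts a_out x1 ?invr1 ?scale1r ?subrr //; lra.
- move=> x t x1 t01; rewrite ball_proj_id ?x1 // clamp_id // H'E /=.
  have -> : a x = 1 by rewrite a_out x1 //; lra.
  have ts0 : ts x = 0 by rewrite /ts a_out x1 ?invr1 ?subrr //; lra.
  have nx : n x = x by rewrite /n a_out x1 ?invr1 ?scale1r //; lra.
  rewrite ts0 nx invr1 mulr1 subr0.
  case: ifPn => [t0|_].
    have -> : t = 0 by apply/eqP; rewrite eq_le t0; case/andP: t01.
    by rewrite addr0 scale1r h0 // lexx ler01.
  by case: ifPn => //; rewrite x1 => xl; exfalso; lra.
- move=> x x1; rewrite ball_proj_id // clamp0 H'E /= mul0r addr0 scale1r.
  by case: ifPn => //; rewrite sub0r oppr_le0; have /andP[->] := ts_itv x x1.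
- move=> x x1; rewrite ball_proj_id // clamp1 H'E /= ball_proj_id // mul1r.
  case: ifPn => [|_]; first by rewrite /ts => xl; exfalso; lra.
  have -> : (a x)^-1 - ts x = 1 by rewrite /ts; lra.
  rewrite /U; case: ifPn => xl; first by rewrite K1 // n_in //; lra.
  by rewrite h1 ?ts_itv //; have [|] := n_out x; first lra.
Qed.

Lemma lift_solvable_ext (u u' : V -> Y) (h h' : V * R -> Z) (w w' : V -> Z) :
  (forall x, `|x| = 1 -> u x = u' x) ->
  (forall (x : V) (t : R), `|x| = 1 -> 0 <= t <= 1 -> h (x, t) = h' (x, t)) ->
  (forall x, `|x| <= 1 -> w x = w' x) ->
  lift_solvable u h w -> lift_solvable u' h' w'.
Proof.
move=> uu hh ww [b [K [cbK bu Kh K0 K1]]]; exists b, K; split => //.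
- by move=> x x1; rewrite bu ?uu.
- by move=> x t x1 t01; rewrite Kh ?hh.
- by move=> x x1; rewrite K0 ?ww.
Qed.

End BallProblems.

(** The explicit retraction of ball * [0, 1] onto the union of the bottom and of
    the side: points move away from the axis until they meet the side. *)
Lemma homotopy_extension (R : realType) (V : normedModType R)
    (Z : topologicalType) (w : V -> Z) (g : V * R -> Z) :
  continuous w ->
  (forall (x : V) (t : R), x != 0 -> continuous_at (x, t) g) ->
  (forall x : V, `|x| = 1 -> g (x, 0) = w x) ->
  exists W : V * R -> Z,
    [/\ continuous W, (forall x : V, `|x| <= 1 -> W (x, 0) = w x) &
        (forall (x : V) (t : R), `|x| = 1 -> 0 <= t -> W (x, t) = g (x, t))].
Proof.
move=> cw cg gw.
exists (fun p => if (1 + p.2) * `|p.1| - 1 <= 0 then w ((1 + p.2) *: p.1)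
                 else g (`|p.1|^-1 *: p.1, (1 + p.2) * `|p.1| - 1)); split.
- move=> [x t].
  have neq0 : 0 <= (1 + t) * `|x| - 1 -> x != 0.
    by apply: contraTneq => ->; rewrite normr0 mulr0 -ltNge; lra.
  cont => /= c0; first by cont.
    have x0 := neq0 c0; cont => /=; rewrite ?normr_eq0 //.
    by apply: cg; rewrite scaler_eq0 invr_eq0 normr_eq0 negb_or x0.
  have x0 : x != 0 by apply: neq0; rewrite c0.
  rewrite c0 gw ?norm_normalize //; congr (w (_ *: _)).
  by apply: (mulIf (x := `|x|)); rewrite ?mulVf ?normr_eq0 //; lra.
- move=> x x1; rewrite /= addr0 mul1r scale1r; case: ifPn => // x1'.
  by exfalso; lra.
- move=> x t x1 t0 /=; rewrite x1 mulr1 invr1 scale1r addrAC subrr add0r.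
  case: ifPn => // t0'; have -> : t = 0 by lra.
  by rewrite addr0 scale1r gw.
Qed.

Section Lifting.
Variables (R : realType) (V : normedModType R) (Y Z : topologicalType).
Variable k : Y -> Z.

(** For the unit ball of dimension q, this is the homotopy extension and lifting
    property of [k] with respect to the pair formed by the ball and its
    boundary. *)
Definition has_lifting : Prop :=
  forall u h w, @lift_problem R V Y Z k u h w -> lift_solvable k u h w.

(** The special case of a constant homotopy on the sphere. *)
Definition strict_problem (u : V -> Y) (w : V -> Z) : Prop :=
  [/\ (forall x, x != 0 -> continuous_at x u), continuous w &
      (forall x, `|x| = 1 -> w x = k (u x))].

Definition strict_solvable (u : V -> Y) (w : V -> Z) : Prop :=
  lift_solvable k u (fun p => k (u p.1)) w.

Hypothesis ck : continuous k.

(** Extending [h] to a homotopy [W] of [w] connects a problem, through the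
    problems in which only the part of [h] after time t remains, to a strict
    one. *)
Lemma strict_lifting :
  (forall u w, strict_problem u w -> strict_solvable u w) -> has_lifting.
Proof.
move=> strict u h w [cu ch cw h0 h1].
have [W [cW W0 Wh]] := homotopy_extension cw ch h0.
apply: (@lift_solvable_ext _ _ _ _ k (fun x => u (x, 0).1) _
  (fun p => h ((p, 0).1.1, Num.max (p, 0).1.2 (p, 0).2)) _
  (fun x => W (x, 0))) => //.
  by move=> x t x1 /andP[t0 t1] /=; rewrite (max_idPl t0).
apply: (@lift_solvable_homotopy _ _ _ _ k (fun q => u q.1)
  (fun q => h (q.1.1, Num.max q.1.2 q.2)) W) => //.
- by move=> x t x0; cont; exact: cu.
- by move=> x s t x0; cont; exact: ch.
- by move=> x t x1 /andP[t0 t1] /=; rewrite (max_idPr t0) Wh.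
- by move=> x t x1 /andP[t0 t1] /=; rewrite (max_idPl t1) h1.
apply: (@lift_solvable_ext _ _ _ _ k u _ (fun p => k (u p.1)) _
  (fun x => W (x, 1))) => //.
  by move=> x t x1 /andP[t0 t1] /=; rewrite (max_idPr t1) h1.
apply: strict; split => //; first by move=> x; cont; exact: cW.
by move=> x x1; rewrite Wh // h1.
Qed.

(** If [u] extends to [b] on the ball, then [u x] moves to [b 0] along
    [b ((1 - t) *: x)]; by homotopy extension the whole problem moves along, and
    ends with a constant map on the sphere. *)
Lemma lifting_by_contraction :
  (forall u w, strict_problem u w ->
     exists2 b : V -> Y, continuous b & forall x, `|x| = 1 -> b x = u x) ->
  (forall y w, continuous w -> (forall x, `|x| = 1 -> w x = k y) ->
     strict_solvable (fun=> y) w) ->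
  has_lifting.
Proof.
move=> ext const; apply: strict_lifting => u w uw.
have [b cb bu] := ext u w uw; have [cu cw wu] := uw.
pose U (p : V * R) := b ((1 - p.2) *: p.1).
have cU : continuous U by move=> p; rewrite /U; cont.
have U0 x : `|x| = 1 -> k (U (x, 0)) = w x.
  by move=> x1; rewrite /U subr0 scale1r bu ?wu.
have ckU (x : V) (t : R) (_ : x != 0) : continuous_at (x, t) (k \o U).
  exact: at_comp (cU (x, t)) (@ck _).
have [W [cW W0 WU]] := homotopy_extension cw ckU U0.
apply: (@lift_solvable_ext _ _ _ _ k (fun x => U (x, 0)) _
  (fun p => k (U ((p, 0).1.1, 0))) _ (fun x => W (x, 0))) => //.
- by move=> x x1; rewrite /U subr0 scale1r bu.
- by move=> x t x1 _; rewrite /U /= subr0 scale1r bu.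
apply: (@lift_solvable_homotopy _ _ _ _ k U
  (fun q => k (U (q.1.1, q.2))) W) => //.
- by move=> x s t _; cont.
- by move=> x t x1 /andP[t0 _]; rewrite WU.
have Ub x : U (x, 1) = b 0 by rewrite /U subrr scale0r.
apply: (@lift_solvable_ext _ _ _ _ k (fun=> b 0) _
  (fun=> k (b 0)) _ (fun x => W (x, 1))) => //.
- by move=> x t x1 _; rewrite Ub.
- apply: const; first by move=> x; cont; exact: cW.
  by move=> x x1; rewrite WU // /= Ub.
Qed.

End Lifting.

Lemma lift_solvable_retract (R : realType) (V V' : normedModType R)
    (Y Z : topologicalType) (k : Y -> Z) (i : V -> V') (r : V' -> V)
    (u : V -> Y) (h : V * R -> Z) (w : V -> Z) :
  continuous i -> cancel i r ->
  (forall x, `|x| = 1 -> `|i x| = 1) -> (forall x, `|x| <= 1 -> `|i x| <= 1) ->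
  lift_solvable k (u \o r) (fun p => h (r p.1, p.2)) (w \o r) ->
  lift_solvable k u h w.
Proof.
move=> ci irK i1 ile [b [K [[cb cK] bu Kh K0 K1]]].
exists (b \o i), (fun p => K (i p.1, p.2)); split.
- by split => p; rewrite /comp; cont.
- by move=> x x1; rewrite /= bu ?i1 //= irK.
- by move=> x t x1 t01; rewrite Kh ?i1 //= irK.
- by move=> x x1; rewrite K0 ?ile //= irK.
- by move=> x x1; rewrite K1 ?ile.
Qed.

Lemma has_lifting_retract (R : realType) (V V' : normedModType R)
    (Y Z : topologicalType) (k : Y -> Z) (i : V -> V') (r : V' -> V) :
  continuous i -> continuous r -> cancel i r ->
  (forall x, `|x| = 1 -> `|i x| = 1) -> (forall x, `|x| <= 1 -> `|i x| <= 1) ->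
  (forall y, y != 0 -> r y != 0) -> (forall y, `|y| = 1 -> `|r y| = 1) ->
  has_lifting V' k -> has_lifting V k.
Proof.
move=> ci cr irK i1 ile r0 r1 lift u h w [cu ch cw h0 h1].
apply: (lift_solvable_retract ci irK) => //; apply: lift; split.
- by move=> y y0; rewrite /comp; cont; exact/cu/r0.
- by move=> y t y0; cont; exact/ch/r0.
- by move=> y; rewrite /comp; cont.
- by move=> y y1 /=; rewrite h0 ?r1.
- by move=> y y1 /=; rewrite h1 ?r1.
Qed.

(** * Maps between quotients *)

Section QuotientMaps.
Variables (T U : Type) (A : set T) (B : set U).
Variables (E : T -> T -> Prop) (F : U -> U -> Prop) (f : T -> U).

(** Reflexivity alone is restricted to [D], because homotopy of maps is
    symmetric and transitive without restriction but only a continuous map is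
    homotopic to itself. *)
Definition equivalence_on (S : Type) (D : set S) (Q : S -> S -> Prop) : Prop :=
  [/\ (forall a, D a -> Q a a), (forall a b, Q a b -> Q b a) &
      (forall a b c, Q a b -> Q b c -> Q a c)].

Hypotheses (eqE : equivalence_on A E) (eqF : equivalence_on B F).
Hypothesis fAB : forall a, A a -> B (f a).
Hypothesis fEF : forall a b, A a -> A b -> E a b -> F (f a) (f b).

Lemma quot_class_eq (S : Type) (D : set S) (Q : S -> S -> Prop) a b :
  equivalence_on D Q -> D a -> D b ->
  [set c | D c /\ Q a c] = [set c | D c /\ Q b c] <-> Q a b.
Proof.
move=> [refl sym trans] Da Db; split => [ab|Qab].
  suff [] : [set c | D c /\ Q a c] b by [].
  by rewrite ab; split => //; exact: refl.
apply/seteqP; split => c [Dc Qc]; split => //.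
  exact: trans (sym _ _ Qab) Qc.
exact: trans Qab Qc.
Qed.

Lemma quot_map_class a : A a ->
  quot_map B F f [set c | A c /\ E a c] = [set b | B b /\ F (f a) b].
Proof.
move=> Aa; have [Er _ _] := eqE; have [_ Fs Ft] := eqF.
apply/seteqP; split => b [Bb].
  move=> [a' [Aa' Eaa'] Fb]; split => //.
  exact: Ft (fEF Aa Aa' Eaa') Fb.
by move=> Fb; split => //; exists a => //; split => //; exact: Er.
Qed.

Lemma quot_map_fun :
  set_fun (quot_by A E) (quot_by B F) (quot_map B F f).
Proof.
by move=> _ [a Aa <-]; exists (f a); [exact: fAB | rewrite quot_map_class].
Qed.

Lemma quot_map_injP :
  set_inj (quot_by A E) (quot_map B F f) <->
  forall a b, A a -> A b -> F (f a) (f b) -> E a b.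
Proof.
split=> [inj a b Aa Ab Fab|inj _ _ /set_mem[a Aa <-] /set_mem[b Ab <-]].
  apply/(quot_class_eq eqE Aa Ab)/inj; rewrite ?inE; first by exists a.
    by exists b.
  by rewrite !quot_map_class //; apply/quot_class_eq => //; exact: fAB.
rewrite !quot_map_class // => ab; apply/quot_class_eq => //.
by apply: inj => //; apply/(quot_class_eq eqF); [exact: fAB..|].
Qed.

Lemma quot_map_surjP :
  set_surj (quot_by A E) (quot_by B F) (quot_map B F f) <->
  forall b, B b -> exists2 a, A a & F (f a) b.
Proof.
split=> [surj b Bb|surj _ [b Bb <-]].
  have [_ [a Aa <-]] := surj _ (ex_intro2 _ _ b Bb erefl).
  rewrite quot_map_class // => /quot_class_eq ab.
  by exists a => //; apply: ab => //; exact: fAB.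
have [a Aa Fab] := surj b Bb.
exists [set c | A c /\ E a c]; first by exists a.
by rewrite quot_map_class //; apply/quot_class_eq => //; exact: fAB.
Qed.

End QuotientMaps.

(** * Homotopies, paths and spheroids parametrized by the line *)

Lemma at_to_subtype (T X : topologicalType) (A : set X) (f : T -> set_type A)
    (p : T) :
  continuous_at p (fun x => sval (f x)) -> continuous_at p f.
Proof.
move=> cf U [_ /= [[W oW <-] /= Wfp WU]]; apply: (filterS WU).
by apply: cf; exact: open_nbhs_nbhs.
Qed.

Lemma continuous_to_subtype (T X : topologicalType) (A : set X)
    (f : T -> set_type A) :
  continuous (fun x => sval (f x)) -> continuous f.
Proof. by move=> cf p; exact: at_to_subtype. Qed.

Lemma continuous_from_subtype (X : topologicalType) (A : set X) :
  continuous (sval : set_type A -> X).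
Proof. exact: initial_continuous. Qed.

Lemma subtype_eq (X : Type) (A : set X) (a b : set_type A) :
  sval a = sval b -> a = b.
Proof.
by move=> ab; apply: eq_sig_hprop => // ? ? ?; exact: eq_irrelevance.
Qed.

Section Homotopies.
Variable R : realType.
Local Notation I := (unit_interval R).

Lemma clamp_in (t : R) : clamp t \in `[0, 1]%classic.
Proof. by apply/mem_set; rewrite /= in_itv /= clamp_itv. Qed.

Definition to_I (t : R) : I := exist _ (clamp t) (clamp_in t).

Lemma to_I_continuous : continuous to_I.
Proof. by apply: continuous_to_subtype; exact: clamp_continuous. Qed.

Definition of_I (t : I) : R := sval t.

Lemma of_I_continuous : continuous of_I.
Proof. exact: continuous_from_subtype. Qed.

Lemma I_itv (t : I) : 0 <= of_I t <= 1.
Proof. by case: t => t /= /set_mem; rewrite /= in_itv. Qed.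

Lemma to_IK (t : I) : to_I (of_I t) = t.
Proof. by apply: subtype_eq; rewrite /= clamp_id ?I_itv. Qed.

Lemma to_I0 : to_I 0 = I0 R.
Proof. exact: (to_IK (I0 R)). Qed.

Lemma to_I1 : to_I 1 = I1 R.
Proof. exact: (to_IK (I1 R)). Qed.

Variables (T X : topologicalType).

(** Homotopies whose parameter runs through [R] avoid reasoning in the subtype
    [0, 1]; [Q] is a condition imposed at every time, so that homotopies
    of spheroids and equivariant homotopies are treated together. *)
Definition line_homotopic (Q : set (T -> X)) (f g : T -> X) : Prop :=
  exists H : T * R -> X,
    [/\ continuous H, (forall x, H (x, 0) = f x), (forall x, H (x, 1) = g x) &
        (forall t, Q (fun x => H (x, t)))].

Lemma line_homotopicP (Q : set (T -> X)) (f g : T -> X) :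
  line_homotopic Q f g <->
  exists H : T * I -> X,
    [/\ continuous H, (forall x, H (x, I0 R) = f x),
        (forall x, H (x, I1 R) = g x) & (forall t, Q (fun x => H (x, t)))].
Proof.
split=> -[H [cH H0 H1 QH]].
  exists (fun p => H (p.1, of_I p.2)).
  split; [|exact: H0|exact: H1|by move=> t; exact: QH].
  by move=> p; cont; exact: of_I_continuous.
exists (fun p => H (p.1, to_I p.2)); split.
- by move=> p; cont; exact: to_I_continuous.
- by move=> x; rewrite to_I0.
- by move=> x; rewrite to_I1.
- by move=> t; exact: (QH (to_I t)).
Qed.

Lemma line_homotopic_equiv (Q : set (T -> X)) :
  equivalence_on [set f | continuous f /\ Q f] (line_homotopic Q).
Proof.
split.
- move=> f [cf Qf]; exists (fun p => f p.1); split => //.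
  by move=> p; cont.
- move=> f g [H [cH H0 H1 QH]]; exists (fun p => H (p.1, 1 - p.2)); split => //.
  + by move=> p; cont.
  + by move=> x; rewrite subr0.
  + by move=> x; rewrite subrr.
  + by move=> t; exact: (QH (1 - t)).
- move=> f g l [H [cH H0 H1 QH]] [K [cK K0 K1 QK]].
  exists (fun p => if p.2 - 2^-1 <= 0 then H (p.1, 2 * p.2)
                   else K (p.1, 2 * p.2 - 1)); split.
  + move=> [x t]; cont => //= t0; [by cont | by cont |].
    have -> : 2 * t = 1 by lra.
    by rewrite subrr H1 K0.
  + by move=> x /=; case: ifPn => [_|h]; [rewrite mulr0 | exfalso; lra].
  + move=> x /=; case: ifPn => [h|_]; first by exfalso; lra.
    by rewrite (_ : 2 * 1 - 1 = 1) //; lra.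
  + move=> t /=; case: (_ <= 0); first exact: (QH (2 * t)).
    exact: (QK (2 * t - 1)).
Qed.

End Homotopies.

Section PathsAndSpheroids.
Variable R : realType.

Lemma joined_by_pathP (X : topologicalType) (x y : X) :
  joined_by_path R x y <->
  exists p : R -> X, [/\ continuous p, p 0 = x & p 1 = y].
Proof.
split=> -[p [cp p0 p1]].
  exists (p \o @to_I R); split; rewrite /= ?to_I0 ?to_I1 //.
  by move=> t; rewrite /comp; cont; exact: to_I_continuous.
exists (p \o @of_I R); split => //.
by move=> t; rewrite /comp; cont; exact: of_I_continuous.
Qed.

Lemma joined_by_path_equiv (X : topologicalType) :
  equivalence_on setT (@joined_by_path R X).
Proof.
have [refl sym trans] := @line_homotopic_equiv R R X setT.
split.
- move=> x _; apply/joined_by_pathP; exists (fun=> x); split => // t.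
  exact: at_cst.
- move=> x y /joined_by_pathP[p [cp p0 p1]]; apply/joined_by_pathP.
  exists (fun t => p (1 - t)); rewrite subr0 subrr; split => // t.
  by cont.
- move=> x y z /joined_by_pathP[p [cp p0 p1]] /joined_by_pathP[r [cr r0 r1]].
  apply/joined_by_pathP.
  have [||H [cH H0 H1 _]] := trans (fun=> x) (fun=> y) (fun=> z).
  + by exists (fun t => p t.2); split => // t; cont.
  + by exists (fun t => r t.2); split => // t; cont.
  exists (fun t => H (0, t)); split => // t; cont; exact: cH.
Qed.

Definition boundary_at (q : nat) (X : topologicalType) (x : X) :
    set (cube R q -> X) :=
  [set a | forall v, cube_boundary v -> a v = x].

Lemma spheroid_homotopicP (q : nat) (X : topologicalType) (x : X)
    (a b : cube R q -> X) :
  spheroid_homotopic x a b <-> line_homotopic R (boundary_at x) a b.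
Proof.
split=> [[H [cH H0 H1 Hx]]|/line_homotopicP[H [cH H0 H1 Hx]]].
  by apply/line_homotopicP; exists H; split => // t v; exact: Hx.
by exists H; split => // v t; exact: Hx.
Qed.

Lemma spheroid_homotopic_equiv (q : nat) (X : topologicalType) (x : X) :
  equivalence_on (spheroid R q X x) (@spheroid_homotopic R q X x).
Proof.
have [refl sym trans] := line_homotopic_equiv R (@boundary_at q X x).
split.
- by move=> a /refl/spheroid_homotopicP.
- by move=> a b /spheroid_homotopicP/sym/spheroid_homotopicP.
- move=> a b c /spheroid_homotopicP ab /spheroid_homotopicP bc.
  exact/spheroid_homotopicP/(trans a b c).
Qed.

End PathsAndSpheroids.

(** * Homotopy groups in terms of the sup norm *)

Section RowNorm.
Variables (R : realType) (q : nat).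

Lemma row_norm_le (x : 'rV[R]_q) (r : R) : 0 <= r ->
  `|x| <= r <-> forall i, `|x ord0 i| <= r.
Proof.
move=> r0; rewrite {1}/Num.norm /= mx_normrE; split.
  by move/bigmax_leP => [_ H] i; exact: (H (ord0, i)).
by move=> H; apply/bigmax_leP; split => // -[i j] _; rewrite ord1; exact: H.
Qed.

Lemma row_norm_attained (x : 'rV[R]_q) : x != 0 ->
  exists i, `|x| = `|x ord0 i|.
Proof.
rewrite -normr_eq0 => /mx_norm_neq0[[i j] /= xij].
by exists j; rewrite /Num.norm /= xij ord1.
Qed.

End RowNorm.

Section Cubes.
Variables (R : realType) (q : nat).

(** The affine identification of the unit ball [-1, 1]^q of the sup norm with
    the cube [0, 1]^q, extended to all rows by clamping. *)
Definition affine_row (x : 'rV[R]_q) : 'rV[R]_q :=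
  \row_i clamp ((x ord0 i + 1) / 2).

Lemma affine_row_cube x : affine_row x \in @cube_set R q.
Proof. by apply/mem_set => i; rewrite mxE clamp_itv. Qed.

Definition to_cube (x : 'rV[R]_q) : cube R q :=
  exist _ (affine_row x) (affine_row_cube x).

Definition of_cube (v : cube R q) : 'rV[R]_q := \row_i (2 * sval v ord0 i - 1).

Lemma to_cube_continuous : continuous to_cube.
Proof.
apply: continuous_to_subtype => x /=; apply: at_row => i.
apply: at_comp; last exact: clamp_continuous.
by cont.
Qed.

Lemma of_cube_continuous : continuous of_cube.
Proof.
move=> v; apply: at_row => i; cont.
exact: continuous_from_subtype.
Qed.

Lemma norm_of_cube v : `|of_cube v| <= 1.
Proof.
apply/row_norm_le => // i; have /set_mem/(_ i) vi := valP v.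
by rewrite mxE ler_norml; move: (sval v ord0 i) vi => x; lra.
Qed.

Lemma to_cubeK x : `|x| <= 1 -> of_cube (to_cube x) = x.
Proof.
move=> /row_norm_le xi; apply/rowP => i; rewrite !mxE.
have := xi ler01 i; rewrite ler_norml => xi01.
by rewrite clamp_id; lra.
Qed.

Lemma of_cube_boundary v : cube_boundary v -> `|of_cube v| = 1.
Proof.
move=> [i vi]; apply/eqP; rewrite eq_le norm_of_cube /=.
have /row_norm_le/(_ i) : `|of_cube v| <= `|of_cube v| by [].
move=> /(_ (normr_ge0 _)); apply: le_trans; rewrite mxE.
case: vi => ->; rewrite ?mulr0 ?mulr1 ?sub0r ?normrN ?normr1 //.
by rewrite ger0_norm; lra.
Qed.

Lemma to_cube_boundary x : `|x| = 1 -> cube_boundary (to_cube x).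
Proof.
move=> x1; have [i xi] := row_norm_attained (norm1_neq0 x1).
exists i; rewrite /= mxE.
have : x ord0 i = 1 \/ x ord0 i = -1.
  by move: xi; rewrite x1; case: (ger0P (x ord0 i)) => _; lra.
case=> ->; last by rewrite addNr mul0r clamp0; left.
by right; rewrite -[RHS]clamp1; congr clamp; lra.
Qed.

End Cubes.

Section HomotopyGroupsOnBalls.
Variables (R : realType) (q : nat) (Y Z : topologicalType) (k : Y -> Z).
Hypothesis ck : continuous k.
Local Notation V := 'rV[R]_q.

Lemma comp_spheroid (y : Y) (a : cube R q -> Y) :
  spheroid R q Y y a -> spheroid R q Z (k y) (k \o a).
Proof.
move=> [ca ay]; split; last by move=> v /ay /= ->.
by move=> v; rewrite /comp; cont.
Qed.

Lemma comp_spheroid_homotopic (y : Y) (a b : cube R q -> Y) :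
  spheroid_homotopic (R := R) y a b ->
  spheroid_homotopic (R := R) (k y) (k \o a) (k \o b).
Proof.
move=> [H [cH H0 H1 Hy]]; exists (k \o H); split => [p|v|v|v t vb] /=.
- by rewrite /comp; cont.
- by rewrite H0.
- by rewrite H1.
- by rewrite Hy.
Qed.

Lemma ball_spheroid (X : topologicalType) (x : X) (a : V -> X) :
  continuous a -> (forall v : V, `|v| = 1 -> a v = x) ->
  spheroid R q X x (a \o @of_cube R q).
Proof.
move=> ca ax; split; last by move=> v /of_cube_boundary /ax.
by move=> v; rewrite /comp; cont; exact: of_cube_continuous.
Qed.

Lemma pi_map_inj_ball (y : Y) (a : V -> Y) (W : V * R -> Z) :
  set_inj (pi_ R q Y y) (pi_map R q y k) ->
  continuous a -> (forall x : V, `|x| = 1 -> a x = y) -> continuous W ->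
  (forall x : V, `|x| <= 1 -> W (x, 0) = k (a x)) ->
  (forall x : V, `|x| <= 1 -> W (x, 1) = k y) ->
  (forall (x : V) (t : R), `|x| = 1 -> 0 <= t <= 1 -> W (x, t) = k y) ->
  exists b : V * R -> Y,
    [/\ continuous b, (forall x : V, `|x| <= 1 -> b (x, 0) = a x),
        (forall x : V, `|x| <= 1 -> b (x, 1) = y) &
        (forall (x : V) (t : R), `|x| = 1 -> 0 <= t <= 1 -> b (x, t) = y)].
Proof.
move=> inj ca ay cW W0 W1 Wy.
have /(_ (a \o @of_cube R q) (fun=> y)) := (quot_map_injP
  (spheroid_homotopic_equiv R q y) (spheroid_homotopic_equiv R q (k y))
  (@comp_spheroid y) (fun a b _ _ => @comp_spheroid_homotopic y a b)).1 inj.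
case=> [||| H [cH H0 H1 Hy]].
- exact: ball_spheroid.
- by split => // v; exact: at_cst.
- apply/spheroid_homotopicP.
  exists (fun p => W (of_cube p.1, clamp p.2)); split.
  + move=> p; cont; [exact: of_cube_continuous | exact: clamp_continuous].
  + by move=> v; rewrite clamp0 W0 // norm_of_cube.
  + by move=> v; rewrite clamp1 W1 // norm_of_cube.
  + by move=> t v /of_cube_boundary v1; rewrite Wy // clamp_itv.
exists (fun p => H (to_cube p.1, to_I p.2)); split.
- by move=> p; cont; [exact: to_cube_continuous | exact: to_I_continuous].
- by move=> x x1; rewrite to_I0 H0 /= to_cubeK.
- by move=> x x1; rewrite to_I1 H1.
- by move=> x t x1 t01; rewrite Hy //; exact: to_cube_boundary.
Qed.

Lemma pi_map_surj_ball (y : Y) (w : V -> Z) :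
  set_surj (pi_ R q Y y) (pi_ R q Z (k y)) (pi_map R q y k) ->
  continuous w -> (forall x : V, `|x| = 1 -> w x = k y) ->
  strict_solvable k (fun=> y) w.
Proof.
move=> surj cw wy.
have /(_ (w \o @of_cube R q)) := (quot_map_surjP
  (spheroid_homotopic_equiv R q y) (spheroid_homotopic_equiv R q (k y))
  (@comp_spheroid y) (fun a b _ _ => @comp_spheroid_homotopic y a b)).1 surj.
case=> [|a [ca ay] Haw]; first exact: ball_spheroid.
have [_ sym _] := spheroid_homotopic_equiv R q (k y).
have [H [cH H0 H1 Hy]] := sym _ _ Haw.
exists (a \o @to_cube R q), (fun p => H (to_cube p.1, to_I p.2)); split.
- split => p; first by rewrite /comp; cont; exact: to_cube_continuous.
  by cont; [exact: to_cube_continuous | exact: to_I_continuous].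
- by move=> x x1; rewrite /= ay //; exact: to_cube_boundary.
- by move=> x t x1 t01; rewrite Hy //; exact: to_cube_boundary.
- by move=> x x1; rewrite to_I0 H0 /= to_cubeK.
- by move=> x x1; rewrite to_I1 H1.
Qed.

End HomotopyGroupsOnBalls.

(** * An n-equivalence has the lifting property in dimensions at most n *)

Section Cylinder.
Variables (R : realType) (V : normedModType R).
Implicit Types (p : V * R) (t : R).

Lemma cylinder_norm p : `|p| = Num.max `|p.1| `|p.2|.
Proof. by []. Qed.

Lemma cylinder_norm1 p : `|p| = 1 ->
  [/\ `|p.1| <= 1, -1 <= p.2 <= 1 & `|p.1| = 1 \/ (p.2 = 1 \/ p.2 = -1)].
Proof.
rewrite cylinder_norm => p1.
have : `|p.1| <= 1 by rewrite -p1 le_max lexx.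
have h2 : `|p.2| <= 1 by rewrite -p1 le_max lexx orbT.
split => //; first by rewrite -ler_norml.
move: p1; case: (leP `|p.1| `|p.2|) => _; last by left.
by case: (ger0P p.2) => _ p21; right; [left | right; lra].
Qed.

(** A deformation of the cylinder over the unit ball, from the identity at time
    0, that preserves the boundary of the cylinder and at time 1 collapses the
    side and the top to the point [(0, 1)]. The base coordinate is dilated and
    clamped, while the dilated side climbs to the top (the second argument of
    the inner maximum); then the height is dilated and clamped, while the top
    shrinks to its centre as far as the height exceeds 1. Heights are
    normalized to [0, 1] inside [s]. *)
Definition slide (q : (V * R) * R) : V * R :=
  let p := q.1 in let t := q.2 in
  let s := (1 + t) * Num.max ((p.2 + 1) / 2) ((1 + t) * `|p.1| - 1) in
  ((1 - Num.max 0 (s - 1)) *: ball_proj ((1 + t) *: p.1),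
   2 * Num.min 1 s - 1).

Lemma slide_continuous : continuous slide.
Proof.
by move=> q; rewrite /slide; cont; exact: ball_proj_continuous.
Qed.

Lemma slide0 p : `|p| = 1 -> slide (p, 0) = p.
Proof.
move=> /cylinder_norm1[p1 p2 _]; rewrite /slide /= addr0 !mul1r scale1r.
rewrite ball_proj_id //.
have -> : Num.max ((p.2 + 1) / 2) (`|p.1| - 1) = (p.2 + 1) / 2.
  by apply/max_idPl; lra.
rewrite (max_idPl _) ?(min_idPr _); [|lra..].
by rewrite subr0 scale1r [RHS]surjective_pairing; congr (_, _); lra.
Qed.

Lemma slide1 p : `|p| = 1 -> `|p.1| = 1 \/ p.2 = 1 -> slide (p, 1) = (0, 1).
Proof.
move=> /cylinder_norm1[p1 p2 _] p12; rewrite /slide /=.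
have -> : Num.max ((p.2 + 1) / 2) ((1 + 1) * `|p.1| - 1) = 1.
  case: p12 => ->.
    by rewrite (max_idPr _); lra.
  by rewrite (max_idPl _); lra.
rewrite (max_idPr _) ?(min_idPl _); [|lra..].
by congr (_, _); [rewrite (_ : 1 - _ = 0) ?scale0r //|]; lra.
Qed.

(** A boundary point whose final height is clamped to 1 ends on the top.
    Otherwise its base coordinate has not shrunk, and the point was on the side,
    where dilation keeps the norm 1, or on the bottom, from where it moves along
    the bottom until its base coordinate is clamped. *)
Lemma norm_slide p t : `|p| = 1 -> 0 <= t <= 1 -> `| slide (p, t) | = 1.
Proof.
move=> p1 /andP[t0 t1]; have [y1 s1 ys] := cylinder_norm1 p1.
rewrite /slide /=; set m := Num.max ((p.2 + 1) / 2) _.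
have mA : (1 + t) * `|p.1| - 1 <= m by rewrite /m le_max lexx orbT.
have ms : (p.2 + 1) / 2 <= m by rewrite /m le_max lexx.
have ty : (1 + t) * `|p.1| <= 1 + t by rewrite ler_piMr //; lra.
have m1 : m <= 1 by rewrite /m ge_max; apply/andP; split; lra.
have m0 : 0 <= m by apply: le_trans ms; lra.
have tm : 0 <= (1 + t) * m <= 1 + t.
  by rewrite mulr_ge0 ?ler_piMr //; lra.
set y := ball_proj _.
have yle : `|y| <= 1 by exact: norm_ball_proj.
have y_out : 1 <= (1 + t) * `|p.1| -> `|y| = 1.
  by move=> h; apply: norm_ball_proj_out; rewrite normrZ ger0_norm //; lra.
rewrite cylinder_norm /=; have [B1|B1] := leP 1 ((1 + t) * m).
  have -> : Num.max 0 ((1 + t) * m - 1) = (1 + t) * m - 1.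
    by apply/max_idPr; lra.
  rewrite (_ : 2 * 1 - 1 = 1) ?normr1; last lra.
  apply/max_idPr; rewrite normrZ ger0_norm; last lra.
  by apply: mulr_ile1 => //; lra.
have -> : Num.max 0 ((1 + t) * m - 1) = 0 by apply/max_idPl; lra.
rewrite subr0 scale1r.
have [yN1|yN1] := leP 1 ((1 + t) * `|p.1|).
  rewrite y_out //; apply/max_idPl; rewrite ler_norml; lra.
have m0' : m = 0.
  rewrite /m; apply/eqP; rewrite eq_le -/m m0 andbT.
  case: ys => [y1'|[s1'|s1']].
  - by exfalso; rewrite y1' in yN1; lra.
  - exfalso; have : m = 1 by apply/eqP; rewrite eq_le m1; move: ms; lra.
    by move=> m1'; rewrite m1' in B1; lra.
  - by rewrite ge_max s1'; apply/andP; split; lra.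
by rewrite m0' !mulr0 sub0r normrN normr1; exact/max_idPr.
Qed.

End Cylinder.

Section RowSplitting.
Variables (R : realType) (q : nat).

Definition row_behead (x : 'rV[R]_q.+1) : 'rV[R]_q * R :=
  (\row_j x ord0 (lift ord0 j), x ord0 ord0).

Definition row_cons (p : 'rV[R]_q * R) : 'rV[R]_q.+1 :=
  \row_i oapp (fun j => p.1 ord0 j) p.2 (unlift ord0 i).

Lemma row_behead_continuous : continuous row_behead.
Proof.
by move=> x; rewrite /row_behead; cont; apply: at_row => i; cont.
Qed.

Lemma row_cons_continuous : continuous row_cons.
Proof.
move=> p; apply: at_row => i.
by case: (unlift ord0 i) => [j|] /=; cont.
Qed.

Lemma row_consK : cancel row_cons row_behead.
Proof.
move=> [y s]; rewrite /row_behead /row_cons mxE unlift_none /=.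
by congr (_, _); apply/rowP => j; rewrite !mxE liftK.
Qed.

Lemma row_beheadK : cancel row_behead row_cons.
Proof.
move=> x; apply/rowP => i; rewrite !mxE.
by case: unliftP => [j ->|->] /=; rewrite ?mxE.
Qed.

Lemma norm_row_cons p : `|row_cons p| = `|p|.
Proof.
apply/eqP; rewrite eq_le; apply/andP; split.
  apply/row_norm_le => // i; rewrite mxE cylinder_norm le_max.
  case: (unlift ord0 i) => [j|] /=; last by rewrite lexx orbT.
  by have /row_norm_le -> := lexx `|p.1|.
have /row_norm_le H := lexx `|row_cons p|.
rewrite cylinder_norm ge_max; apply/andP; split.
  apply/row_norm_le => // j.
  by have := H (normr_ge0 _) (lift ord0 j); rewrite mxE liftK.
by have := H (normr_ge0 _) ord0; rewrite mxE unlift_none.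
Qed.

Lemma norm_row_behead x : `|row_behead x| = `|x|.
Proof. by rewrite -norm_row_cons row_beheadK. Qed.

End RowSplitting.

Section LiftingOfEquivalences.
Variables (R : realType) (Y Z : topologicalType) (k : Y -> Z).
Hypothesis ck : continuous k.

(** Composing with the deformation [slide] makes [u] constant on the side and
    on the top of the cylinder. What remains on the bottom is a spheroid [a],
    and [W] is a null homotopy of [k \o a]; by injectivity [a] itself is null
    homotopic, which extends the deformed map to the cylinder. Homotopy
    extension carries the extension back along the deformation. *)
Lemma sphere_extension (q : nat) (u : 'rV[R]_q * R -> Y)
    (w : 'rV[R]_q * R -> Z) :
  (forall y, set_inj (pi_ R q Y y) (pi_map R q y k)) ->
  strict_problem k u w ->
  exists2 b : 'rV[R]_q * R -> Y, continuous b & forall p, `|p| = 1 -> b p = u p.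
Proof.
move=> inj [cu cw wu]; set V := 'rV[R]_q.
have cs := @slide_continuous R V.
have cbp := @ball_proj_continuous R V.
have s1 (x : V) : `|(ball_proj x, - 1 : R)| = 1.
  rewrite cylinder_norm /= normrN normr1; apply/max_idPr.
  exact: norm_ball_proj.
have i01 : 0 <= (1 : R) <= 1 by rewrite lexx ler01.
pose a (x : V) := u (slide (ball_proj x, -1, 1)).
have ca : continuous a.
  by move=> x; rewrite /a; cont; exact/cu/norm1_neq0/norm_slide.
pose W (p : V * R) := w (slide (ball_proj p.1, 2 * p.2 - 1, 1)).
have cW : continuous W by move=> p; rewrite /W; cont.
pose y := u (0, 1).
have top1 (x : V) : slide (ball_proj x, 1, 1) = (0, 1).
  apply: slide1; last by right.
  rewrite cylinder_norm normr1; apply/max_idPr; exact: norm_ball_proj.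
have side1 (x : V) (s : R) : `|x| = 1 -> -1 <= s <= 1 ->
    slide (x, s, 1) = (0, 1).
  move=> x1 s01; apply: slide1; last by left.
  by rewrite cylinder_norm /= x1; apply/max_idPl; rewrite ler_norml.
have projx (x : V) : `|x| = 1 -> ball_proj x = x.
  by move=> x1; rewrite ball_proj_id // x1.
have n01 : `|(0, 1) : V * R| = 1.
  by rewrite cylinder_norm normr0 normr1; apply/max_idPr.
have [||||||b [cb b0 b1 bside]] := @pi_map_inj_ball R q Y Z k ck y a W (inj y).
- exact: ca.
- by move=> x x1; rewrite /a projx // side1 // lexx; lra.
- exact: cW.
- move=> x x1; rewrite /W /a mulr0 sub0r wu //.
  exact/norm_slide.
- by move=> x x1; rewrite /W mulr1 (_ : 2 - 1 = 1) ?top1 ?wu //; lra.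
- by move=> x t x1 t01; rewrite /W /= projx // side1 ?wu //; lra.
pose g (p : (V * R) * R) := u (slide (`|p.1|^-1 *: p.1, 1 - clamp p.2)).
have cg (x : V * R) (t : R) : x != 0 -> continuous_at (x, t) g.
  move=> x0; have cc := @clamp_continuous R.
  rewrite /g; cont; first by rewrite /= normr_eq0.
  apply/cu/norm1_neq0/norm_slide; first exact: norm_normalize.
  by have := clamp_itv t; rewrite /=; lra.
have [||G [cG G0 Gg]] := @homotopy_extension R _ Y
  (fun p : V * R => b (p.1, (p.2 + 1) / 2)) g _ cg.
- by move=> p; cont.
- move=> [x s] /[dup] p1 /cylinder_norm1[/= x1 s01 xs].
  rewrite /g /= p1 invr1 scale1r clamp0 subr0.
  case: xs => [x1'|[->|->]].
  + by rewrite side1 // bside //; lra.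
  + rewrite -[x]ball_proj_id // top1 ball_proj_id //.
    by rewrite (_ : (1 + 1) / 2 = 1) ?b1 //; lra.
  + by rewrite addNr mul0r b0 // /a ball_proj_id.
exists (fun p => G (p, 1)); first by move=> p; cont.
move=> p p1; rewrite Gg // /g /= p1 invr1 scale1r clamp1 subrr.
by rewrite slide0.
Qed.

Lemma pi0_mapP :
  (set_inj (pi0 R Y) (pi0_map R k) <->
     forall x y, joined_by_path R (k x) (k y) -> joined_by_path R x y) /\
  (set_surj (pi0 R Y) (pi0 R Z) (pi0_map R k) <->
     forall z, exists y, joined_by_path R (k y) z).
Proof.
have kk x y : joined_by_path R x y -> joined_by_path R (k x) (k y).
  move=> [p [cp p0 p1]]; exists (k \o p); rewrite /= p0 p1; split => // t.
  by rewrite /comp; cont.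
have [eY eZ] := (joined_by_path_equiv R Y, joined_by_path_equiv R Z).
have kT (a : Y) : setT a -> setT (k a) by [].
split.
  rewrite (quot_map_injP eY eZ kT (fun a b _ _ => kk a b)).
  by split=> H x y; [exact: H | move=> _ _; exact: H].
rewrite (quot_map_surjP eY eZ kT (fun a b _ _ => kk a b)).
split=> H z; first by have [y _ yz] := H z I; exists y.
by move=> _; have [y yz] := H z; exists y.
Qed.

Lemma row0_eq0 (x : 'rV[R]_0) : x = 0.
Proof. exact: thinmx0. Qed.

(** In dimension 0 the cylinder is an interval and the statement is about path
    components, without base points. *)
Lemma sphere_extension0 (u : 'rV[R]_0 * R -> Y) (w : 'rV[R]_0 * R -> Z) :
  set_inj (pi0 R Y) (pi0_map R k) ->
  strict_problem k u w ->
  exists2 b : 'rV[R]_0 * R -> Y, continuous b & forall p, `|p| = 1 -> b p = u p.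
Proof.
move=> /pi0_mapP.1 inj [cu cw wu].
have e1 : 2 * 1 - 1 = 1 :> R by lra.
have e2 : (1 + 1) / 2 = 1 :> R by lra.
have n1 (s : R) : `|s| = 1 -> `|(0, s) : 'rV[R]_0 * R| = 1.
  by move=> s1; rewrite cylinder_norm normr0 s1; apply/max_idPr.
have /inj/joined_by_pathP[p [cp p0 p1]] :
    joined_by_path R (k (u (0, -1))) (k (u (0, 1))).
  apply/joined_by_pathP; exists (fun t => w (0, 2 * t - 1)); split.
  - by move=> t; cont.
  - by rewrite mulr0 sub0r wu ?n1 // normrN normr1.
  - by rewrite e1 wu ?n1 ?normr1.
exists (fun q => p ((q.2 + 1) / 2)); first by move=> q; cont.
move=> [x s] /cylinder_norm1[/= _ _]; rewrite (row0_eq0 x) normr0.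
case=> [/esym/eqP|[->|->]]; first by rewrite oner_eq0.
  by rewrite e2.
by rewrite addNr mul0r p0.
Qed.

Definition le_ext (q : nat) (n : option nat) : Prop :=
  ltn_ext q n \/ n = Some q.

Lemma le_extS q n : le_ext q.+1 n -> ltn_ext q n.
Proof. by case: n => [n|] //= [/ltnW|[->]]. Qed.

Variable n : option nat.
Hypothesis kn : n_equivalence R n k.

Lemma pi_map_surj q y : le_ext q.+1 n ->
  set_surj (pi_ R q.+1 Y y) (pi_ R q.+1 Z (k y)) (pi_map R q.+1 y k).
Proof.
have [_ _ _ /(_ q.+1 y isT)[bij surj]] := kn.
by case=> [/bij[]|/surj].
Qed.

Lemma n_equivalence_pi0_surj z : exists y, joined_by_path R (k y) z.
Proof.
have [_ bij surj _] := kn; move: z; apply/pi0_mapP.2.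
case: (n) bij surj => [[|m]|] bij surj.
- exact: surj.
- by have [] := bij isT.
- by have [] := bij I.
Qed.

Lemma cylinder_lifting q : le_ext q.+1 n -> has_lifting ('rV[R]_q * R)%type k.
Proof.
move=> qn; apply: lifting_by_contraction => //.
  move=> u w; have qn' := le_extS qn.
  have [_ bij0 _ bij] := kn.
  case: q qn qn' u w => [|q] qn qn' u w.
    by apply: sphere_extension0; have [] := bij0 qn'.
  by apply: sphere_extension => y; have [/(_ qn')[]] := bij q.+1 y isT.
move=> y w cw wy.
apply: (lift_solvable_retract (r := @row_behead R q) (@row_cons_continuous R q)
  (@row_consK R q)).
- by move=> x; rewrite norm_row_cons.
- by move=> x; rewrite norm_row_cons.
apply: (@pi_map_surj_ball R q.+1 Y Z k ck y (w \o @row_behead R q)).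
- exact: pi_map_surj.
- by move=> x; rewrite /comp; cont; exact: row_behead_continuous.
- by move=> x x1 /=; rewrite wy // norm_row_behead.
Qed.

(** In dimension 0 the sphere is empty, and the lifting property says that
    every point of [Z] is joined by a path to a point of the image. *)
Lemma row_lifting q : le_ext q n -> has_lifting 'rV[R]_q k.
Proof.
case: q => [_|q qn].
  move=> u h w [_ _ cw _ _].
  have [y /joined_by_pathP[p [cp p0 p1]]] := n_equivalence_pi0_surj (w 0).
  have nosphere (x : 'rV[R]_0) : `|x| = 1 -> False.
    by rewrite (row0_eq0 x) normr0; lra.
  exists (fun=> y), (fun q => p (1 - q.2)); split.
  - by split => x; cont.
  - by move=> x /nosphere.
  - by move=> x t /nosphere.
  - by move=> x _; rewrite subr0 (row0_eq0 x).
  - by move=> x _; rewrite subrr.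
apply: (has_lifting_retract (@row_behead_continuous R q)
  (@row_cons_continuous R q) (@row_beheadK R q)).
- by move=> x; rewrite norm_row_behead.
- by move=> x; rewrite norm_row_behead.
- by move=> x; rewrite -[row_cons x == 0]normr_eq0 norm_row_cons normr_eq0.
- by move=> x; rewrite norm_row_cons.
exact: cylinder_lifting.
Qed.

End LiftingOfEquivalences.

(** * From the sup norm to Euclidean disks *)

Lemma at0_squeeze (R : realType) (V W : normedModType R) (f : V -> W)
    (g : V -> R) :
  f 0 = 0 -> continuous g -> g 0 = 0 -> (forall x, `|f x| <= g x) ->
  continuous_at 0 f.
Proof.
move=> f0 cg g0 fg; rewrite /continuous_at f0.
apply/cvgr0Pnorm_lt => e e0.
have : \forall x \near (0 : V), g x < e.
  by apply: (cvgr_lt _ (cg 0)); rewrite g0.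
by apply: filterS => x; exact: le_lt_trans.
Qed.

Section EuclideanNorm.
Variables (R : realType) (q : nat).
Implicit Types x : 'rV[R]_q.

Definition enorm x : R := Num.sqrt (\sum_i x ord0 i ^+ 2).

Lemma sum_sq_ge0 x : 0 <= \sum_i x ord0 i ^+ 2.
Proof. by apply: sumr_ge0 => i _; exact: sqr_ge0. Qed.

Lemma enorm_ge0 x : 0 <= enorm x.
Proof. exact: sqrtr_ge0. Qed.

Lemma enorm_continuous : continuous enorm.
Proof.
move=> x; apply: (@at_comp _ _ _ _ Num.sqrt); last exact: sqrt_continuous.
by apply: at_sum => i; rewrite /GRing.exp /=; cont.
Qed.

Lemma enormZ (c : R) x : enorm (c *: x) = `|c| * enorm x.
Proof.
rewrite /enorm -sqrtr_sqr -sqrtrM ?sqr_ge0 // mulr_sumr.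
by congr Num.sqrt; apply: eq_bigr => i _; rewrite mxE exprMn.
Qed.

Lemma norm_le_enorm x : `|x| <= enorm x.
Proof.
apply/row_norm_le => [|i]; first exact: enorm_ge0.
rewrite -sqrtr_sqr ler_sqrt ?sum_sq_ge0 // (bigD1 i) //= lerDl.
by apply: sumr_ge0 => j _; exact: sqr_ge0.
Qed.

Lemma enorm0 : enorm 0 = 0.
Proof. by rewrite -[0 in LHS](scale0r (0 : 'rV[R]_q)) enormZ normr0 mul0r. Qed.

Lemma enorm_eq0 x : (enorm x == 0) = (x == 0).
Proof.
apply/eqP/eqP => [x0|->]; last exact: enorm0.
by apply/eqP; rewrite -normr_le0 -x0 norm_le_enorm.
Qed.

Lemma disk_setE x : disk_set x <-> enorm x <= 1.
Proof.
rewrite /disk_set /= /enorm -{2}sqrtr1 ler_sqrt ?ler01 //.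
Qed.

Lemma sphere_setE x : sphere_set x <-> enorm x = 1.
Proof.
rewrite /sphere_set /= /enorm; split=> [->|h]; first exact: sqrtr1.
by rewrite -[LHS]sqr_sqrtr ?sum_sq_ge0 // h expr1n.
Qed.

(** Radial rescaling, which exchanges the Euclidean and the sup norm. *)
Definition to_sup x : 'rV[R]_q := (enorm x / `|x|) *: x.

Definition to_euclid x : 'rV[R]_q := (`|x| / enorm x) *: x.

Lemma norm_to_sup x : `|to_sup x| = enorm x.
Proof.
have [->|x0] := eqVneq x 0; first by rewrite /to_sup scaler0 normr0 enorm0.
rewrite normrZ ger0_norm ?divr_ge0 ?enorm_ge0 //.
by rewrite divfK ?normr_eq0.
Qed.

Lemma enorm_to_euclid x : enorm (to_euclid x) = `|x|.
Proof.
have [->|x0] := eqVneq x 0; first by rewrite /to_euclid scaler0 normr0 enorm0.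
rewrite enormZ ger0_norm ?divr_ge0 ?enorm_ge0 //.
by rewrite divfK ?enorm_eq0.
Qed.

Lemma to_supK : cancel to_sup to_euclid.
Proof.
move=> x; have [->|x0] := eqVneq x 0.
  by rewrite /to_euclid /to_sup !scaler0.
have e0 : enorm x != 0 by rewrite enorm_eq0.
have n0 : `|x| != 0 by rewrite normr_eq0.
rewrite /to_euclid norm_to_sup /to_sup enormZ scalerA.
set c := enorm x / `|x|; have c0 : c != 0 by rewrite mulf_neq0 ?invr_neq0.
rewrite ger0_norm ?divr_ge0 ?enorm_ge0 //; move: c c0 => c c0.
by rewrite -[enorm x / _]invf_div mulfK // mulVf // scale1r.
Qed.

Lemma to_sup_continuous : continuous to_sup.
Proof.
move=> x; have [->|x0] := eqVneq x 0; last first.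
  have ce := enorm_continuous.
  by rewrite /to_sup; cont; rewrite normr_eq0.
apply: (at0_squeeze _ enorm_continuous enorm0) => [|y].
  by rewrite /to_sup scaler0.
by rewrite norm_to_sup.
Qed.

Lemma to_euclid_continuous : continuous to_euclid.
Proof.
move=> x; have [->|x0] := eqVneq x 0; last first.
  have ce := enorm_continuous.
  by rewrite /to_euclid; cont; rewrite enorm_eq0.
apply: (at0_squeeze _ (@norm_continuous _ _) (normr0 _)) => [|y].
  by rewrite /to_euclid scaler0.
by rewrite -[leRHS]enorm_to_euclid norm_le_enorm.
Qed.

End EuclideanNorm.

Section DiskProjections.
Variables (R : realType) (q : nat).

Definition to_disk_row (x : 'rV[R]_q) : 'rV[R]_q :=
  (Num.max 1 (enorm x))^-1 *: x.

Lemma to_disk_row_in x : to_disk_row x \in @disk_set R q.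
Proof.
apply/mem_set/disk_setE; rewrite /to_disk_row enormZ ger0_norm.
  rewrite mulrC ler_pdivrMr ?mul1r ?le_max ?lexx ?orbT //.
  by rewrite lt_max ltr01.
by rewrite invr_ge0 le_max ler01.
Qed.

Definition to_disk (x : 'rV[R]_q) : disk R q :=
  exist _ (to_disk_row x) (to_disk_row_in x).

Definition of_disk (v : disk R q) : 'rV[R]_q := sval v.

Definition of_sphere (v : sphere R q) : 'rV[R]_q := sval v.

Lemma of_disk_continuous : continuous of_disk.
Proof. exact: continuous_from_subtype. Qed.

Lemma to_disk_continuous : continuous to_disk.
Proof.
apply: continuous_to_subtype => x /=; have ce := @enorm_continuous R q.
by rewrite /to_disk_row; cont; rewrite gt_eqF // lt_max ltr01.
Qed.

Lemma enorm_of_disk v : enorm (of_disk v) <= 1.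
Proof. by apply/disk_setE/set_mem; exact: valP. Qed.

Lemma enorm_of_sphere v : enorm (of_sphere v) = 1.
Proof. by apply/sphere_setE/set_mem; exact: valP. Qed.

Lemma of_sphere_disk v : of_disk (sphere_disk v) = of_sphere v.
Proof. by []. Qed.

Lemma of_diskK v : to_disk (of_disk v) = v.
Proof.
apply: subtype_eq; rewrite /= /to_disk_row.
by rewrite (max_idPl (enorm_of_disk v)) invr1 scale1r.
Qed.

Lemma normalize_in (x : 'rV[R]_q) : x != 0 ->
  (enorm x)^-1 *: x \in @sphere_set R q.
Proof.
move=> x0; apply/mem_set/sphere_setE.
by rewrite enormZ ger0_norm ?invr_ge0 ?enorm_ge0 // mulVf // enorm_eq0.
Qed.

Definition normalize (x : 'rV[R]_q) (x0 : x != 0) : sphere R q :=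
  exist _ ((enorm x)^-1 *: x) (normalize_in x0).

Variable v0 : sphere R q.

(** Radial projection, with [v0] as a default value at the origin. *)
Definition to_sphere (x : 'rV[R]_q) : sphere R q :=
  if pselect (x != 0) is left x0 then normalize x0 else v0.

Lemma sval_to_sphere x : x != 0 -> sval (to_sphere x) = (enorm x)^-1 *: x.
Proof. by move=> x0; rewrite /to_sphere; case: pselect. Qed.

Lemma to_sphere_continuous (x : 'rV[R]_q) : x != 0 -> continuous_at x to_sphere.
Proof.
move=> x0; apply: at_to_subtype.
apply: (@at_near _ _ _ (fun x => (enorm x)^-1 *: x)).
  have : \forall y \near x, 0 < `|y|.
    by apply: (cvgr_gt _ (@norm_continuous _ _ x)); rewrite normr_gt0.
  by apply: filterS => y; rewrite normr_gt0 => /sval_to_sphere.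
have ce := @enorm_continuous R q.
by cont; rewrite enorm_eq0.
Qed.

Lemma of_sphereK v : to_sphere (of_sphere v) = v.
Proof.
have v1 := enorm_of_sphere v.
apply: subtype_eq; rewrite sval_to_sphere ?v1 ?invr1 ?scale1r //.
by rewrite -enorm_eq0 v1 oner_eq0.
Qed.

Lemma to_sphereZ (c : R) x :
  0 < c -> x != 0 -> to_sphere (c *: x) = to_sphere x.
Proof.
move=> c0 x0; apply: subtype_eq.
rewrite !sval_to_sphere ?scaler_eq0 ?gt_eqF // enormZ gtr0_norm //.
by rewrite scalerA invfM mulrAC mulVf ?gt_eqF // mul1r.
Qed.

Lemma sphere_disk_to_sphere x : enorm x = 1 ->
  sphere_disk (to_sphere x) = to_disk x.
Proof.
move=> x1; apply: subtype_eq; rewrite /= sval_to_sphere.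
  by rewrite /to_disk_row x1 maxxx.
by rewrite -enorm_eq0 x1 oner_eq0.
Qed.

End DiskProjections.

Definition has_disk_lifting (R : realType) (q : nat) (Y Z : topologicalType)
    (k : Y -> Z) : Prop :=
  forall (u : sphere R q -> Y) (h : sphere R q * R -> Z) (w : disk R q -> Z),
    continuous u -> continuous h -> continuous w ->
    (forall v, h (v, 0) = w (sphere_disk v)) ->
    (forall v, h (v, 1) = k (u v)) ->
    exists (b : disk R q -> Y) (K : disk R q * R -> Z),
      [/\ continuous b /\ continuous K,
          (forall v, b (sphere_disk v) = u v),
          (forall v t, 0 <= t <= 1 -> K (sphere_disk v, t) = h (v, t)),
          (forall v, K (v, 0) = w v) &
          (forall v, K (v, 1) = k (b v))].

(** The hypothesis on inhabitants is for dimension 0, where the map from the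
    empty sphere to [Y] has to be represented by a map defined on rows. *)
Lemma disk_lifting (R : realType) (q : nat) (Y Z : topologicalType)
    (k : Y -> Z) :
  (Z -> exists y : Y, True) -> has_lifting 'rV[R]_q k -> has_disk_lifting R q k.
Proof.
move=> YZ lift u h w cu ch cw h0 h1; set V := 'rV[R]_q.
pose w' (x : V) := w (to_disk (to_euclid x)).
have cw' : continuous w'.
  move=> x; rewrite /w'; cont; first exact: to_euclid_continuous.
  exact: to_disk_continuous.
suff [u' [h' [uhw' uu hh]]] : exists (u' : V -> Y) (h' : V * R -> Z),
    [/\ lift_problem k u' h' w', (forall v, u' (to_sup (of_sphere v)) = u v) &
        (forall v t, h' (to_sup (of_sphere v), t) = h (v, t))].
  have [b [K [[cb cK] bu Kh K0 K1]]] := lift u' h' w' uhw'.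
  have cs := @to_sup_continuous R q; have cd := @of_disk_continuous R q.
  exists (fun v => b (to_sup (of_disk v))).
  exists (fun p => K (to_sup (of_disk p.1), p.2)); split.
  - by split => p; cont.
  - move=> v; rewrite of_sphere_disk bu ?uu //.
    by rewrite norm_to_sup enorm_of_sphere.
  - move=> v t t01; rewrite of_sphere_disk Kh ?hh //.
    by rewrite norm_to_sup enorm_of_sphere.
  - move=> v; rewrite K0 ?norm_to_sup ?enorm_of_disk // /w'.
    by rewrite to_supK of_diskK.
  - by move=> v; rewrite K1 ?norm_to_sup ?enorm_of_disk.
have [[v0 _]|nosphere] := pselect (exists v : sphere R q, True); last first.
  have nov (x : V) : x = 0.
    apply/eqP/negPn/negP => x0; apply: nosphere.
    by exists (normalize x0).
  have [y _] := YZ (w (to_disk 0)).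
  have no1 (x : V) : `|x| = 1 -> False.
    by rewrite (nov x) normr0 => /esym/eqP; rewrite oner_eq0.
  exists (fun=> y), (fun=> k y); split.
  - split=> //; try by move=> x *; exact: at_cst.
    + by move=> x /no1.
  - by move=> v; case: nosphere; exists v.
  - by move=> v; case: nosphere; exists v.
have sup_neq0 (v : sphere R q) : to_sup (of_sphere v) != 0.
  by rewrite -normr_eq0 norm_to_sup enorm_of_sphere oner_eq0.
have cS := @to_sphere_continuous R q v0.
have SK (v : sphere R q) : to_sphere v0 (to_sup (of_sphere v)) = v.
  have v1 := enorm_of_sphere v.
  rewrite to_sphereZ ?of_sphereK ?divr_gt0 ?v1 ?ltr01 ?normr_gt0 //.
    by rewrite -enorm_eq0 v1 oner_eq0.
  by rewrite -enorm_eq0 v1 oner_eq0.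
exists (fun x => u (to_sphere v0 x)), (fun p => h (to_sphere v0 p.1, p.2)).
split; last 2 first.
- by move=> v; rewrite SK.
- by move=> v t; rewrite SK.
split => //.
- by move=> x x0; cont; exact: cS.
- by move=> x t x0; cont; exact: cS.
move=> x x1; have x0 := norm1_neq0 x1.
rewrite h0 /w' -(sphere_disk_to_sphere v0) ?enorm_to_euclid //.
rewrite to_sphereZ // divr_gt0 ?normr_gt0 // lt_neqAle enorm_ge0 andbT eq_sym.
by rewrite enorm_eq0.
Qed.

(** * Path spaces and subspaces with an action *)

Section PathSpace.
Variables (R : realType) (Z : topologicalType).

(** Paths are the continuous maps on the line that are constant outside of
    [0, 1]: the line is locally compact, so that the exponential law for the
    compact-open topology applies. *)
Definition path_set : set {compact-open, R -> Z} :=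
  [set g : R -> Z | continuous g /\ forall t, g (clamp t) = g t].

Definition path_space : Type := path_set.

HB.instance Definition _ := Topological.copy path_space (set_type path_set).

Definition path_eval (p : path_space * R) : Z := (sval p.1 : R -> Z) p.2.

Lemma path_eval_clamp g t : path_eval (g, clamp t) = path_eval (g, t).
Proof. by have /set_mem[_] := valP g; apply. Qed.

Lemma path_eq (g h : path_space) :
  (forall t, 0 <= t <= 1 -> path_eval (g, t) = path_eval (h, t)) -> g = h.
Proof.
move=> gh; apply: subtype_eq; apply/funext => t.
have := gh (clamp t) (clamp_itv t).
by rewrite !path_eval_clamp.
Qed.

Lemma path_eval_continuous : continuous path_eval.
Proof.
have -> : path_eval = uncurry (fun g : path_space => sval g : R -> Z).
  by apply/funext => -[].
apply: continuous_uncurry.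
- exact: locally_compactR.
- exact: Rhausdorff.
- exact: (@continuous_from_subtype {compact-open, R -> Z} path_set).
- by move=> g; have /set_mem[] := valP g.
Qed.

Section MakePath.
Variables (X : topologicalType) (H : X * R -> Z).
Hypothesis cH : continuous H.

Definition clamped_path (x : X) (t : R) : Z := H (x, clamp t).

Lemma clamped_path_in x : clamped_path x \in path_set.
Proof.
apply/mem_set; split; last by move=> t; rewrite /clamped_path clampK.
by move=> t; rewrite /clamped_path; cont; exact: clamp_continuous.
Qed.

Definition make_path (x : X) : path_space :=
  exist _ (clamped_path x) (clamped_path_in x).

Lemma make_pathE x t : path_eval (make_path x, t) = H (x, clamp t).
Proof. by []. Qed.

Lemma make_path_continuous : continuous make_path.
Proof.
apply: (@continuous_to_subtype X {compact-open, R -> Z} path_set).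
apply: (@continuous_curry_fun X R Z (fun p => H (p.1, clamp p.2))).
by move=> p; cont; exact: clamp_continuous.
Qed.

End MakePath.
End PathSpace.

Section PathMSpace.
Variables (R : realType) (M : monoidType) (Z : mspaceType M).
Local Notation path_space := (path_space R Z).

Definition act_eval (m : M) (p : path_space * R) : Z := mact m (path_eval p).

Lemma act_eval_continuous m : continuous (act_eval m).
Proof.
move=> p; rewrite /act_eval; cont; last exact: mact_continuous1.
exact: path_eval_continuous.
Qed.

Definition path_mact (m : M) : path_space -> path_space :=
  make_path (@act_eval_continuous m).

Lemma path_mactE m g t :
  path_eval (path_mact m g, t) = mact m (path_eval (g, t)).
Proof. by rewrite make_pathE /act_eval path_eval_clamp. Qed.

Lemma path_mact1 g : path_mact 1%g g = g.
Proof. by apply: path_eq => t _; rewrite path_mactE mact1. Qed.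

Lemma path_mactM m1 m2 g :
  path_mact (m1 * m2)%g g = path_mact m1 (path_mact m2 g).
Proof. by apply: path_eq => t _; rewrite !path_mactE mactM. Qed.

HB.instance Definition _ := hasMonoidAction.Build M path_space
  path_mact1 path_mactM.

Lemma path_mact_continuous :
  continuous (fun mx : discrete_topology M * path_space =>
                mact (mx.1 : M) mx.2 : path_space).
Proof.
apply: (continuous_discrete_action (f := path_mact)) => m.
exact: make_path_continuous.
Qed.

HB.instance Definition _ := hasContinuousAction.Build M path_space
  path_mact_continuous.

End PathMSpace.

Section SubMSpace.
Variables (M : monoidType) (X : mspaceType M) (A : set X).
Hypothesis stable : forall m x, A x -> A (mact m x).

(** The proof of stability is an argument of the type, from which the action is
    inferred. *)
Definition sub_mspace (_ : forall m x, A x -> A (mact m x)) : Type := A.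

Local Notation S := (sub_mspace stable).

HB.instance Definition _ := Topological.copy S (set_type A).

Lemma sub_mact_in m (x : S) : mact m (sval x) \in A.
Proof. by apply/mem_set/stable/set_mem; exact: valP. Qed.

Definition sub_mact (m : M) (x : S) : S :=
  exist _ (mact m (sval x)) (sub_mact_in m x).

Lemma sub_mact1 x : sub_mact 1%g x = x.
Proof. by apply: subtype_eq; rewrite /= mact1. Qed.

Lemma sub_mactM m1 m2 x : sub_mact (m1 * m2)%g x = sub_mact m1 (sub_mact m2 x).
Proof. by apply: subtype_eq; rewrite /= mactM. Qed.

HB.instance Definition _ := hasMonoidAction.Build M S sub_mact1 sub_mactM.

Lemma sub_mact_continuous :
  continuous (fun mx : discrete_topology M * S => mact (mx.1 : M) mx.2 : S).
Proof.
apply: (continuous_discrete_action (f := sub_mact)) => m.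
apply: continuous_to_subtype => x /=; cont; last exact: mact_continuous1.
exact: continuous_from_subtype.
Qed.

HB.instance Definition _ := hasContinuousAction.Build M S sub_mact_continuous.

End SubMSpace.

(** * Equivariant lifting over projective cells *)

Definition free_mset (M : monoidType) (P : choiceType) : Type := (M * P)%type.

Section FreeMSet.
Variables (M : monoidType) (P : choiceType).

HB.instance Definition _ := Choice.copy (free_mset M P) (M * P)%type.

Definition free_mact (m : M) (x : free_mset M P) : free_mset M P :=
  ((m * x.1)%g, x.2).

Lemma free_mact1 x : free_mact 1%g x = x.
Proof. by case: x => a e; rewrite /free_mact /= mul1g. Qed.

Lemma free_mactM m1 m2 x :
  free_mact (m1 * m2)%g x = free_mact m1 (free_mact m2 x).
Proof. by rewrite /free_mact /= mulgA. Qed.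

HB.instance Definition _ := hasMonoidAction.Build M (free_mset M P)
  free_mact1 free_mactM.

End FreeMSet.

Lemma slice_continuous (P : choiceType) (D E : topologicalType)
    (f : discrete_topology P * D -> E) (e : discrete_topology P) :
  continuous f -> continuous (fun v => f (e, v)).
Proof. by move=> cf v; cont. Qed.

Section CellLifting.
Variables (R : realType) (M : monoidType).

(** An equivariant section [s] of the action map from the free M-set [M * P] to
    [P] writes each [e] as [m e'], where [m] and [e'] depend equivariantly on
    [e]. Given lifts [l] chosen separately for each [e'], the formula
    [m (l e' v)] is then an equivariant lift. *)
Lemma projective_extension (P : msetType M) (S D : topologicalType)
    (i : S -> D) (E B : mspaceType M) (p : E -> B)
    (a : discrete_topology P * trivial_mspace S -> E)
    (w : discrete_topology P * trivial_mspace D -> B) :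
  projective_mset P -> equivariant p -> equivariant a -> equivariant w ->
  (forall e : P, exists l : D -> E,
     [/\ continuous l, (forall v, l (i v) = a (e, v)) &
         (forall v, p (l v) = w (e, v))]) ->
  exists L : discrete_topology P * trivial_mspace D -> E,
    [/\ mmaps L, (forall e v, L (e, i v) = a (e, v)) &
        (forall x, p (L x) = w x)].
Proof.
move=> projP ep ea ew /choice[l lP].
pose ev (x : free_mset M P) : P := mact x.1 x.2.
have [|e|s es evs] := projP (free_mset M P) ev.
- by move=> m x; rewrite /ev mactM.
- by exists (1%g, e); rewrite /ev /= mact1.
have sM m e : s (mact m e) = ((m * (s e).1)%g, (s e).2) by exact: es.
have sE e : mact (s e).1 (s e).2 = e := evs e.
exists (fun x => mact (s x.1).1 (l (s x.1).2 x.2)); split.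
- split.
    apply: (@continuous_discrete_action P D E
      (fun e v => mact (s e).1 (l (s e).2 v))) => e v.
    have [cl _ _] := lP (s e).2.
    by cont; exact: mact_continuous1.
  by move=> m [e v] /=; rewrite sM /= mactM.
- move=> e v /=; have [_ -> _] := lP (s e).2.
  by rewrite -ea; congr (a (_, _)); exact: sE.
- move=> [e v] /=; rewrite ep; have [_ _ ->] := lP (s e).2.
  by rewrite -ew; congr (w (_, _)); exact: sE.
Qed.

Definition has_cell_lifting (q : nat) (E B : mspaceType M) (p : E -> B) :
    Prop :=
  forall (P : msetType M)
    (a : discrete_topology P * trivial_mspace (sphere R q) -> E)
    (w : discrete_topology P * trivial_mspace (disk R q) -> B),
  projective_mset P -> mmaps a -> mmaps w ->
  (forall x, p (a x) = w (cell_boundary x)) ->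
  exists L : discrete_topology P * trivial_mspace (disk R q) -> E,
    [/\ mmaps L, (forall x, L (cell_boundary x) = a x) &
        (forall x, p (L x) = w x)].

Section MappingPathSpace.
Variables (Y Z : mspaceType M) (k : Y -> Z).
Hypothesis ek : equivariant k.

Definition mapping_path_set : set (Y * path_space R Z) :=
  [set p | path_eval (p.2, 1) = k p.1].

Lemma mapping_path_stable m p :
  mapping_path_set p -> mapping_path_set (mact m p).
Proof. by move=> pk; rewrite /mapping_path_set /= path_mactE pk ek. Qed.

(** The path fibration replacing [k]: a map into it over [Z] is a map to [Y]
    together with a homotopy. *)
Definition mapping_path : Type := sub_mspace mapping_path_stable.

HB.instance Definition _ := MSpace.copy mapping_path
  (sub_mspace mapping_path_stable).

Definition mp_val (n : mapping_path) : Y * path_space R Z := sval n.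

Lemma mp_val_continuous : continuous mp_val.
Proof. exact: continuous_from_subtype. Qed.

Lemma mp_valP n : path_eval ((mp_val n).2, 1) = k (mp_val n).1.
Proof. by have /set_mem := valP n. Qed.

Definition mp_start (n : mapping_path) : Z := path_eval ((mp_val n).2, 0).

Lemma mp_start_mmap : mmaps mp_start.
Proof.
split; last by move=> m n; rewrite /mp_start path_mactE.
move=> n; rewrite /mp_start; cont; last exact: path_eval_continuous.
exact: mp_val_continuous.
Qed.

Lemma mapping_path_lifting q :
  has_disk_lifting R q k -> has_cell_lifting q mp_start.
Proof.
move=> lift P a w projP [ca ea] [cw ew] aw.
have [|L [mL La Lw]] := projective_extension (i := @sphere_disk R q) projP
  mp_start_mmap.2 ea ew; last by exists L; split => // -[e v]; exact: La.
move=> e.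
pose c v := mp_val (a (e, v)).
have cc : continuous c.
  move=> v; rewrite /c; cont; last exact: mp_val_continuous.
  exact: (slice_continuous ca).
have cpe := @path_eval_continuous R Z.
have [|||||b [K [[cb cK] bu Kh K0 K1]]] := lift (fun v => (c v).1)
  (fun p => path_eval ((c p.1).2, p.2)) (fun v => w (e, v)).
- by move=> v; cont.
- by move=> v; cont.
- exact: (slice_continuous cw).
- by move=> v; exact: (aw (e, v)).
- by move=> v; exact: mp_valP.
have lP v : (b v, make_path cK v) \in mapping_path_set.
  by apply/mem_set; rewrite /mapping_path_set /= make_pathE clamp1.
exists (fun v => exist _ (b v, make_path cK v) (lP v) : mapping_path); split.
- apply: continuous_to_subtype => v /=; cont; exact: make_path_continuous.
- move=> v; apply: subtype_eq => /=; rewrite bu [RHS]surjective_pairing.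
  congr (_, _); apply: path_eq => t t01.
  by rewrite make_pathE clamp_id ?Kh.
- by move=> v; rewrite /mp_start make_pathE clamp0 K0.
Qed.

End MappingPathSpace.
End CellLifting.

(** * Induction over the skeleta *)

Section Skeleta.
Variables (R : realType) (M : monoidType).

Lemma mmaps_comp (X Y Z : mspaceType M) (f : X -> Y) (g : Y -> Z) :
  mmaps f -> mmaps g -> mmaps (g \o f).
Proof.
move=> [cf ef] [cg eg]; split; last by move=> m x; rewrite /= ef eg.
by move=> x; rewrite /comp; cont.
Qed.

Lemma mpushout_eq (A B C D T : mspaceType M) (f : A -> B) (g : A -> C)
    (i : B -> D) (j : C -> D) (h h' : D -> T) :
  is_mpushout f g i j -> mmaps h -> mmaps h' ->
  (forall b, h (i b) = h' (i b)) -> (forall c, h (j c) = h' (j c)) -> h = h'.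
Proof.
move=> [mi mj fg univ] mh mh' hi hj.
have [|h0 [_ uniq]] :=
  univ T (h \o i) (h \o j) (mmaps_comp mi mh) (mmaps_comp mj mh).
  by move=> a /=; rewrite fg.
have <- : h0 = h by apply: uniq.
by apply: uniq; split => // x /=; rewrite ?hi ?hj.
Qed.

(** That [l] lifts [F] follows from the uniqueness part of the universal
    property, applied to the maps [p \o l] and [F] to [Z]. *)
Lemma mpushout_lifting (A B C D E Z : mspaceType M) (f : A -> B) (g : A -> C)
    (i : B -> D) (j : C -> D) (p : E -> Z) (F : D -> Z) (u : B -> E)
    (v : C -> E) :
  is_mpushout f g i j -> mmaps p -> mmaps F -> mmaps u -> mmaps v ->
  (forall a, u (f a) = v (g a)) ->
  (forall b, p (u b) = F (i b)) -> (forall c, p (v c) = F (j c)) ->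
  exists l : D -> E,
    [/\ mmaps l, (forall x, p (l x) = F x) & (forall b, l (i b) = u b)].
Proof.
move=> po mp mF mu mv fg pu pv; have [_ _ _ univ] := po.
have [l [[ml li lj] _]] := univ E u v mu mv fg.
have pl : p \o l = F.
  apply: (mpushout_eq po (mmaps_comp ml mp) mF) => x /=; last by rewrite lj.
  by rewrite li.
by exists l; split => // x; rewrite -pl.
Qed.

Variables (X : mspaceType M) (C : projective_cw R X).
Variables (E B : mspaceType M) (p : E -> B) (F : X -> B).
Hypotheses (mp : mmaps p) (mF : mmaps F).

Definition skel_lift (n : nat) (g : cw_skel C n -> E) : Prop :=
  mmaps g /\ forall x, p (g x) = F (@cw_inj _ _ _ C n x).

Lemma cw_inj_mmap n : mmaps (@cw_inj _ _ _ C n).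
Proof. by have [] := cw_colimit C. Qed.

Lemma skel_lift0 : has_cell_lifting R 0 p -> exists g, @skel_lift 0 g.
Proof.
move=> lift; have [mi0 [r mr [ri ir]]] := cw_skel0_iso C.
pose P := cw_cells C 0%N.
have nosphere (v : sphere R 0) : False.
  have := enorm_of_sphere v.
  by rewrite (row0_eq0 (of_sphere v)) enorm0 => /esym/eqP; rewrite oner_eq0.
pose a (x : discrete_topology P * trivial_mspace (sphere R 0)) : E :=
  False_rect E (nosphere x.2).
pose w (x : discrete_topology P * trivial_mspace (disk R 0)) : B :=
  F (@cw_inj _ _ _ C 0%N (cw_skel0 x.1)).
have [|||L [[cL eL] _ Lw]] := lift P a w (@cw_cells_projective _ _ _ C 0%N).
- by split => [[e v]|m [e v]]; exfalso; exact: (nosphere v).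
- apply: mmaps_comp mF; apply: mmaps_comp (cw_inj_mmap 0).
  apply: mmaps_comp mi0; split; last by move=> m [].
  by move=> x; exact: cvg_fst.
- by move=> [e v]; exfalso; exact: (nosphere v).
pose o : trivial_mspace (disk R 0) := to_disk (0 : 'rV[R]_0).
exists (fun x => L (r x, o)); split.
  split; last first.
    by move=> m x; rewrite -eL mr.2.
  have [cr _] := mr.
  by move=> x; cont.
by move=> x; rewrite Lw /w /= ir.
Qed.

Lemma skel_liftS n (g : cw_skel C n -> E) :
  has_cell_lifting R n.+1 p -> skel_lift g ->
  exists2 g' : cw_skel C n.+1 -> E,
    skel_lift g' & forall x, g' (@cw_incl _ _ _ C n x) = g x.
Proof.
move=> lift [mg gF]; have po := @cw_pushout _ _ _ C n.
have [mi mj ij _] := po.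
have [_ inj_incl _] := cw_colimit C.
have ma := @cw_attach_mmap _ _ _ C n.
have mFn := mmaps_comp (cw_inj_mmap n.+1) mF.
have [|L [mL La Lw]] := lift _ _ _ (@cw_cells_projective _ _ _ C n.+1)
  (mmaps_comp ma mg) (mmaps_comp mj mFn).
  by move=> x /=; rewrite gF -inj_incl ij.
have [||c|g' [mg' pg' gi]] := mpushout_lifting po mp mFn mg mL.
- by move=> x /=; rewrite La.
- by move=> x /=; rewrite gF -inj_incl.
- exact: Lw.
by exists g'.
Qed.

Lemma skel_lifting n :
  (forall q, (q <= n)%N -> has_cell_lifting R q p) -> exists g, @skel_lift n g.
Proof.
elim: n => [|n IH] lift; first exact/skel_lift0/lift.
have [|g gl] := IH; first by move=> q qn; apply: lift; exact: leqW.
by have [|g' gl' _] := skel_liftS _ gl; [exact: lift | exists g'].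
Qed.

Lemma cw_lifting_dim d : cw_dim C d ->
  (forall q, (q <= d)%N -> has_cell_lifting R q p) ->
  exists2 G : X -> E, mmaps G & forall x, p (G x) = F x.
Proof.
move=> [[_ [r mr [_ ir]]] _] /skel_lifting[g [mg gF]].
exists (g \o r); first exact: mmaps_comp mr mg.
by move=> x /=; rewrite gF ir.
Qed.

Lemma cw_lifting_infinite : (forall q, has_cell_lifting R q p) ->
  exists2 G : X -> E, mmaps G & forall x, p (G x) = F x.
Proof.
move=> lift.
pose T n := {g : cw_skel C n -> E | skel_lift g}.
have t0 : T 0%N by apply: cid; exact/skel_lift0/lift.
have tS n (t : T n) :
    {t' : T n.+1 | forall x, sval t' (@cw_incl _ _ _ C n x) = sval t x}.
  case: t => g gl; apply: cid.
  by have [g' gl' g'g] := skel_liftS (lift n.+1) gl; exists (exist _ g' gl').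
pose t := fix t n : T n := if n is m.+1 then sval (tS m (t m)) else t0.
have tE n x : sval (t n.+1) (@cw_incl _ _ _ C n x) = sval (t n) x.
  exact: svalP (tS n (t n)) x.
have [_ inj_incl univ] := cw_colimit C.
have tm n : mmaps (sval (t n)) by have [] := svalP (t n).
have tF n x : p (sval (t n) x) = F (@cw_inj _ _ _ C n x).
  by have [_ ->] := svalP (t n).
have [G [[mG GE] _]] := univ E (fun n => sval (t n)) tm tE.
suff pG : p \o G = F by exists G => // x; rewrite -pG.
have [|G' [_ uniq]] := univ B (fun n => F \o @cw_inj _ _ _ C n)
  (fun n => mmaps_comp (cw_inj_mmap n) mF).
  by move=> n a /=; rewrite inj_incl.
have <- : G' = p \o G.
  by apply: uniq; split; [exact: mmaps_comp | move=> n a /=; rewrite GE tF].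
by apply: uniq.
Qed.

End Skeleta.

(** * Paths with lifted endpoints *)

Section EndpointsFibration.
Variables (R : realType) (M : monoidType) (Y Z : mspaceType M) (k : Y -> Z).
Hypotheses (ck : continuous k) (ek : equivariant k).

(** The homotopy pullback of [k] with itself: a map from [X] into it consists of
    two maps from [X] to [Y] and of a homotopy between their composites with
    [k]. *)
Definition relative_path_set : set ((Y * Y) * path_space R Z) :=
  [set q | path_eval (q.2, 0) = k q.1.1 /\ path_eval (q.2, 1) = k q.1.2].

Lemma relative_path_stable m q :
  relative_path_set q -> relative_path_set (mact m q).
Proof. by move=> [q0 q1]; split; rewrite /= path_mactE ?q0 ?q1 ek. Qed.

Definition relative_path : Type := sub_mspace relative_path_stable.

HB.instance Definition _ := MSpace.copy relative_path
  (sub_mspace relative_path_stable).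

Definition rp_val (b : relative_path) : (Y * Y) * path_space R Z := sval b.

Lemma rp_val_continuous : continuous rp_val.
Proof. exact: continuous_from_subtype. Qed.

Lemma rp_valP b : relative_path_set (rp_val b).
Proof. by have /set_mem := valP b. Qed.

Definition make_rp (q : (Y * Y) * path_space R Z) (qP : relative_path_set q) :
  relative_path := exist _ q (mem_set qP).

Lemma k_path_eval_continuous : continuous (k \o @path_eval R Y).
Proof. by move=> p; rewrite /comp; cont; exact: path_eval_continuous. Qed.

Definition map_path : path_space R Y -> path_space R Z :=
  make_path k_path_eval_continuous.

Lemma map_pathE g t : path_eval (map_path g, t) = k (path_eval (g, t)).
Proof. by rewrite make_pathE /= path_eval_clamp. Qed.

Definition endpoints (g : path_space R Y) :=
  ((path_eval (g, 0), path_eval (g, 1)), map_path g).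

Lemma endpoints_in g : relative_path_set (endpoints g).
Proof. by split; rewrite map_pathE. Qed.

Definition path_incl (g : path_space R Y) : relative_path :=
  make_rp (endpoints_in g).

Lemma path_incl_mmap : mmaps path_incl.
Proof.
have cpe := @path_eval_continuous R Y.
have cmp : continuous map_path by exact: make_path_continuous.
split; first by apply: continuous_to_subtype => g /=; rewrite /endpoints; cont.
move=> m g; apply: subtype_eq; rewrite /= /endpoints /=.
congr (_, _); first by rewrite !path_mactE.
by apply: path_eq => t _; rewrite map_pathE !path_mactE map_pathE ek.
Qed.

Variable V : normedModType R.

(** A path of [Y] with a parameter in the ball is a map on the cylinder over the
    ball. The two lifted endpoints given by [w] and the paths given by [u]
    define a map [U] on the boundary of this cylinder, and the paths in [Z]
    given by [w] fill the cylinder. *)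
Lemma path_incl_lifting : has_lifting (V * R)%type k -> has_lifting V path_incl.
Proof.
move=> lift; apply: strict_lifting.
move=> u w [cu cw wu].
have cpe := @path_eval_continuous R Y.
have cpz := @path_eval_continuous R Z.
have crv := rp_val_continuous.
pose w0 x := (rp_val (w x)).1.1.
pose w1 x := (rp_val (w x)).1.2.
have cw0 : continuous w0 by move=> x; rewrite /w0; cont.
have cw1 : continuous w1 by move=> x; rewrite /w1; cont.
pose W (q : V * R) := path_eval ((rp_val (w q.1)).2, (q.2 + 1) / 2).
have cW : continuous W by move=> q; rewrite /W; cont.
(* The sphere of the product norm is the union of the two ends, where
   [`|q.1| <= `|q.2|], and of the side; [U] is extended to the complement of
   the origin by homogeneity. *)
pose U (q : V * R) := if `|q.1| - `|q.2| <= 0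
  then if q.2 <= 0 then w0 (`|q.2|^-1 *: q.1) else w1 (`|q.2|^-1 *: q.1)
  else path_eval (u (`|q.1|^-1 *: q.1), (`|q.1|^-1 * q.2 + 1) / 2).
have wu0 (x : V) : `|x| = 1 -> w0 x = path_eval (u x, 0).
  by move=> x1; rewrite /w0 wu.
have wu1 (x : V) : `|x| = 1 -> w1 x = path_eval (u x, 1).
  by move=> x1; rewrite /w1 wu.
have cU (q : V * R) : q != 0 -> continuous_at q U.
  case: q => x s q0; have x0s0 : `|x| <= `|s| -> s != 0.
    move=> xs; apply: contraNneq q0 => s0; move: xs.
    by rewrite s0 normr0 normr_le0 => /eqP ->.
  rewrite /U; cont => //= c.
  - have s0 : s != 0 by apply: x0s0; lra.
    cont => /=.
    + exact: cvg_snd.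
    + by move=> _; cont; rewrite normr_eq0.
    + by move=> _; cont; rewrite normr_eq0.
    + by move/eqP; rewrite (negPf s0).
  - have x0 : x != 0.
      apply: contraNneq q0 => x0; move: c.
      rewrite x0 normr0 sub0r oppr_ge0 normr_le0 => /eqP ->.
      by [].
    have n0 := norm1_neq0 (norm_normalize x0).
    by cont; rewrite /= ?normr_eq0 //; exact: cu.
  - have xs : `|x| = `|s| by lra.
    have s0 : s != 0 by apply: x0s0; rewrite xs.
    have x1 : `| (`|s|^-1 *: x) | = 1.
      by rewrite normrZ normfV normr_id xs mulVf // normr_eq0.
    rewrite xs wu0 // wu1 //; case: (ger0P s) s0 => [s_ge0|s_lt0] s0.
      case: ifPn => [s_le0|_].
        by case/eqP: s0; apply/eqP; rewrite eq_le s_le0.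
      by rewrite mulVf //; congr (path_eval (_, _)); lra.
    rewrite (ltW s_lt0); congr (path_eval (_, _)).
    by rewrite invrN mulNr mulVf // addNr mul0r.
have norm_ball_pm (x : V) (s : R) :
    `|x| <= 1 -> `|s| = 1 -> `|(x, s) : V * R| = 1.
  by move=> x1 s1; rewrite cylinder_norm /= s1; apply/max_idPr.
have U0 (x : V) : `|x| <= 1 -> U (x, -1) = w0 x.
  move=> x1; rewrite /U /= normrN normr1 invr1 scale1r.
  by case: ifPn => [_|h]; [case: ifPn => // h | ]; exfalso; lra.
have U1 (x : V) : `|x| <= 1 -> U (x, 1) = w1 x.
  move=> x1; rewrite /U /= normr1 invr1 scale1r.
  by case: ifPn => [_|h]; [case: ifPn => // h | ]; exfalso; lra.
have Uu (x : V) (s : R) : `|x| = 1 -> -1 <= s <= 1 ->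
    U (x, s) = path_eval (u x, (s + 1) / 2).
  move=> x1 s1; rewrite /U /= x1 invr1 scale1r mul1r.
  case: ifPn => // h.
  have {h}s1' : `|s| = 1.
    by apply/eqP; rewrite eq_le ler_norml s1; move: h; lra.
  rewrite s1' invr1 scale1r wu0 // wu1 //.
  case: (ger0P s) s1' => [s_ge0|s_lt0] s1'.
    case: ifPn => [s_le0|_]; first by exfalso; lra.
    by congr (path_eval (_, _)); lra.
  by rewrite (ltW s_lt0); congr (path_eval (_, _)); lra.
have Wk (q : V * R) : `|q| = 1 -> W q = k (U q).
  case: q => x s q1; have [/= x1 s1 xs] := cylinder_norm1 q1.
  case: (eqVneq `|x| 1) => [x1'|x1'].
    by rewrite Uu // /W /= wu // map_pathE.
  have [e0 e1] := rp_valP (w x).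
  case: xs => [/eqP|[->|->]]; first by rewrite (negPf x1').
    by rewrite U1 // /W /= (_ : (1 + 1) / 2 = 1) ?e1 //; lra.
  by rewrite U0 // /W /= addNr mul0r e0.
have [|b [K [[cb cK] bU KW K0 K1]]] :=
  lift U (fun q => k (U q.1)) W.
  split => //.
  - by move=> q t q0; cont; exact: cU.
  - by move=> q /Wk.
have cbp := @ball_proj_continuous R V.
have cc := @clamp_continuous R.
pose bl (p : V * R) := b (ball_proj p.1, 2 * p.2 - 1).
have cbl : continuous bl by move=> p; rewrite /bl; cont.
pose Kl (p : (V * R) * R) := K ((ball_proj p.1.1, 2 * p.2 - 1), clamp p.1.2).
have cKl : continuous Kl by move=> p; rewrite /Kl; cont.
pose q (p : V * R) :=
  ((w0 (ball_proj p.1), w1 (ball_proj p.1)), make_path cKl p).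
have e1 : 2 * 1 - 1 = 1 :> R by lra.
have qP p : relative_path_set (q p).
  have nb := norm_ball_proj p.1.
  split; rewrite make_pathE ?clamp0 ?clamp1 /Kl /= ?mulr0 ?sub0r ?e1.
    by rewrite KW ?U0 ?norm_ball_pm ?normrN ?normr1 ?clamp_itv.
  by rewrite KW ?U1 ?norm_ball_pm ?normr1 ?clamp_itv.
have norm_side (x : V) (t : R) :
    `|x| = 1 -> 0 <= t <= 1 -> `|(x, 2 * t - 1) : V * R| = 1.
  move=> x1 t01; rewrite cylinder_norm /= x1; apply/max_idPl.
  by rewrite ler_norml; lra.
have norm_in (x : V) (s : R) :
    `|x| <= 1 -> -1 <= s <= 1 -> `|(x, s) : V * R| <= 1.
  by move=> x1 s1; rewrite cylinder_norm ge_max x1 ler_norml.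
exists (make_path cbl), (fun p => make_rp (qP p)); split.
- split; first exact: make_path_continuous.
  apply: continuous_to_subtype => p /=; rewrite /q; cont.
  exact: make_path_continuous.
- move=> x x1; apply: path_eq => t t01.
  rewrite make_pathE clamp_id // /bl /= ball_proj_id ?x1 //.
  rewrite bU ?norm_side ?Uu //; last lra.
  by congr (path_eval (_, _)); lra.
- move=> x t x1 t01; apply: subtype_eq.
  rewrite /= /q /endpoints /= ball_proj_id ?x1 // wu0 // wu1 //.
  congr (_, _); apply: path_eq => s s01.
  rewrite make_pathE map_pathE clamp_id // /Kl /= ball_proj_id ?x1 //.
  rewrite clamp_id // KW ?norm_side //= Uu //; last lra.
  by congr (k (path_eval (_, _))); lra.
- move=> x x1; apply: subtype_eq; rewrite /= /q /= ball_proj_id //.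
  rewrite /w0 /w1 -surjective_pairing [RHS]surjective_pairing; congr (_, _).
  apply: path_eq => s s01.
  rewrite make_pathE clamp_id // /Kl /= ball_proj_id // clamp0 K0.
    by rewrite /W /=; congr (path_eval (_, _)); lra.
  by apply: norm_in => //; lra.
- move=> x x1; apply: subtype_eq; rewrite /= /q /endpoints /= ball_proj_id //.
  rewrite !make_pathE clamp0 clamp1 /bl /= ball_proj_id // mulr0 sub0r e1.
  rewrite !bU ?U0 ?U1 ?norm_ball_pm ?normrN ?normr1 //; congr (_, _).
  apply: path_eq => s s01.
  rewrite map_pathE !make_pathE clamp_id // /Kl /bl /= ball_proj_id // clamp1.
  by rewrite K1 // norm_in //; lra.
Qed.

End EndpointsFibration.

(** * Compression and the theorem *)

Section MHomotopies.
Variables (R : realType) (M : monoidType) (X Y : mspaceType M).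

Lemma mhomotopicP (f g : X -> Y) :
  mhomotopic R f g <-> line_homotopic R (@equivariant M X Y) f g.
Proof.
split=> [[H [[cH eH] H0 H1]]|/line_homotopicP[H [cH H0 H1 eH]]].
  apply/line_homotopicP; exists H; split => // t m x.
  exact: (eH m (x, t)).
by exists H; split => //; split => // m [x t]; exact: (eH t m x).
Qed.

Lemma mhomotopic_equiv : equivalence_on (@mmaps M X Y) (@mhomotopic R M X Y).
Proof.
have [refl sym trans] := line_homotopic_equiv R (@equivariant M X Y).
split.
- by move=> f /refl/mhomotopicP.
- by move=> f g /mhomotopicP/sym/mhomotopicP.
- move=> f g h /mhomotopicP fg /mhomotopicP gh.
  exact/mhomotopicP/(trans f g h).
Qed.

Lemma path_mhomotopic (g : X -> path_space R Y) : mmaps g ->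
  mhomotopic R (fun x => path_eval (g x, 0)) (fun x => path_eval (g x, 1)).
Proof.
move=> [cg eg]; apply/mhomotopicP.
exists (fun p => path_eval (g p.1, p.2)); split => //.
  by move=> p; cont; exact: path_eval_continuous.
by move=> t m x; rewrite eg path_mactE.
Qed.

End MHomotopies.

Section Compression.
Variables (R : realType) (M : monoidType).

Lemma mhomotopic_comp (X Y Z : mspaceType M) (k : Y -> Z) (f g : X -> Y) :
  mmaps k -> mhomotopic R f g -> mhomotopic R (k \o f) (k \o g).
Proof.
move=> mk [H [mH H0 H1]]; exists (k \o H); split.
- exact: mmaps_comp.
- by move=> x; rewrite /= H0.
- by move=> x; rewrite /= H1.
Qed.

Definition has_compression (X Y Z : mspaceType M) (k : Y -> Z) : Prop :=
  forall f : X -> Z, mmaps f ->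
    exists2 g : X -> Y, mmaps g & mhomotopic R f (k \o g).

Definition cw_below (X : mspaceType M) (C : projective_cw R X)
    (P : nat -> Prop) : Prop :=
  (exists2 d, cw_dim C d & forall q, (q <= d)%N -> P q) \/ (forall q, P q).

(** A lift of [f] to the path fibration is a map [g] to [Y] with a homotopy from
    [f] to [k \o g]. *)
Lemma cw_compression (X Y Z : mspaceType M) (C : projective_cw R X)
    (k : Y -> Z) :
  mmaps k -> cw_below C (fun q => has_disk_lifting R q k) ->
  has_compression X k.
Proof.
move=> [ck ek] lift f mf.
have mN := mp_start_mmap R ek.
have [G mG Gf] : exists2 G : X -> mapping_path R ek,
    mmaps G & forall x, mp_start (G x) = f x.
  case: lift => [[d Cd lift]|lift].
    by apply: (cw_lifting_dim mN mf Cd) => q /lift; exact: mapping_path_lifting.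
  by apply: (cw_lifting_infinite C mN mf) => q; exact: mapping_path_lifting.
have [cG eG] := mG; have cv := @mp_val_continuous R M Y Z k ek.
have m1 : mmaps (fun x => (mp_val (G x)).1).
  split; first by move=> x; cont.
  by move=> m x; rewrite eG.
have m2 : mmaps (fun x => (mp_val (G x)).2).
  split; first by move=> x; cont.
  by move=> m x; rewrite eG.
exists (fun x => (mp_val (G x)).1) => //.
have := path_mhomotopic m2.
rewrite (_ : (fun x => path_eval (_, 0)) = f); last exact/funext.
rewrite (_ : (fun x => path_eval (_, 1)) =
  k \o (fun x => (mp_val (G x)).1)) //.
by apply/funext => x; exact: mp_valP.
Qed.

(** Compressing the homotopy [H] gives a homotopy [g] between maps that are only
    homotopic to [f0] and [f1]; the two components of [J] in [Y] are homotopies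
    from [f0] and [f1] to these maps. *)
Lemma mhomotopic_of_compression (X Y Z : mspaceType M) (k : Y -> Z)
    (ck : continuous k) (ek : equivariant k) (f0 f1 : X -> Y) :
  has_compression X (path_incl (R := R) ck ek) -> mmaps f0 -> mmaps f1 ->
  mhomotopic R (k \o f0) (k \o f1) -> mhomotopic R f0 f1.
Proof.
move=> compr [c0 e0] [c1 e1] /mhomotopicP[H [cH H0 H1 eH]].
have [refl sym trans] := mhomotopic_equiv R X Y.
have qP x : relative_path_set k ((f0 x, f1 x), make_path cH x).
  by split; rewrite make_pathE ?clamp0 ?clamp1.
have [|g mg [J [[cJ eJ] J0 J1]]] := compr (fun x => make_rp ek (qP x)).
  split.
    apply: continuous_to_subtype => x /=; cont.
    exact: make_path_continuous.
  move=> m x; apply: subtype_eq; rewrite /= e0 e1; congr (_, _).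
  by apply: path_eq => t _; rewrite path_mactE !make_pathE eH.
have crv := @rp_val_continuous R M Y Z k ek.
pose j i p := if i then (rp_val (J p)).1.1 else (rp_val (J p)).1.2.
have mj i : mmaps (j i).
  split; last by move=> m p; rewrite /j eJ; case: i.
  by move=> p; rewrite /j; case: i; cont.
apply: (trans _ (fun x => path_eval (g x, 0))).
  by exists (j true); split => // x; rewrite /j ?J0 ?J1.
apply: (trans _ (fun x => path_eval (g x, 1))).
  exact: path_mhomotopic.
apply: sym; exists (j false); split => // x; rewrite /j ?J0 ?J1 //.
Qed.

End Compression.

Theorem theorem2p6 (R : realType) (M : monoidType) (X Y Z : mspaceType M)
    (C : projective_cw R X) (n : option nat) (k : Y -> Z) :
  equivariant k -> n_equivalence R n k ->
  ((exists2 d, cw_dim C d & ltn_ext d n) \/ n = None ->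
    set_bij (mclasses R X Y) (mclasses R X Z) (mclasses_map R X k)) /\
  (forall d, cw_dim C d -> n = Some d ->
    set_surj (mclasses R X Y) (mclasses R X Z) (mclasses_map R X k)).
Proof.
move=> ek kn; have ck : continuous k by case: kn.
have mk : mmaps k by [].
have eY := mhomotopic_equiv R X Y; have eZ := mhomotopic_equiv R X Z.
have kf (f : X -> Y) : mmaps f -> mmaps (k \o f).
  by move=> mf; exact: mmaps_comp.
have kfg (f g : X -> Y) : mmaps f -> mmaps g -> mhomotopic R f g ->
  mhomotopic R (k \o f) (k \o g) by move=> _ _; exact: mhomotopic_comp.
have disk q : le_ext q n -> has_disk_lifting R q k.
  move=> qn; apply: disk_lifting; last exact: row_lifting qn.
  by move=> z; have [y _] := n_equivalence_pi0_surj ck kn z; exists y.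
have disk' q : le_ext q.+1 n -> has_disk_lifting R q (path_incl (R := R) ck ek).
  move=> qn; apply: disk_lifting.
    move=> b; have cy : continuous (fun p : Y * R => p.1).
      by move=> p; cont; exact: cvg_fst.
    by exists (make_path cy (rp_val b).1.1).
  by apply: path_incl_lifting; exact: cylinder_lifting qn.
have surj : cw_below C (fun q => le_ext q n) ->
    set_surj (mclasses R X Y) (mclasses R X Z) (mclasses_map R X k).
  move=> below; apply/(quot_map_surjP eY eZ kf kfg) => f mf.
  have [|g mg fg] := @cw_compression R M X Y Z C k mk _ f mf.
    case: below => [[d Cd dn]|dn]; [left; exists d => // q /dn|right => q];
      exact: disk.
  by exists g => //; have [_ sym _] := eZ; exact: sym.
have le_extW q d : (q <= d)%N -> le_ext d n -> le_ext q n.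
  case: (n) => [m|] qd; last by left.
  case=> [/= dm|[md]]; first by left; exact: leq_ltn_trans dm.
  by move: qd; rewrite -md leq_eqVlt => /predU1P[->|]; [right|left].
split=> [dn|d Cd nd]; last first.
  apply: surj; left; exists d => // q qd; apply: (le_extW q d qd).
  by right.
have below' : cw_below C (fun q => le_ext q.+1 n).
  case: dn => [[d Cd dn]|->]; [left; exists d => // q qd|by right => q; left].
  apply: (le_extW q.+1 d.+1) => //; case: (n) dn => [m|] /= dm; last by left.
  by move: dm; rewrite leq_eqVlt => /predU1P[<-|]; [right|left].
split.
- exact: (quot_map_fun eY eZ kf kfg).
- apply/(quot_map_injP eY eZ kf kfg) => f0 f1 mf0 mf1.
  apply: (mhomotopic_of_compression (ck := ck) (ek := ek)) => //.
  apply: (@cw_compression R M X _ _ C); first exact: path_incl_mmap.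
  by case: below' => [[d Cd dn']|dn']; [left; exists d => // q /dn'|right => q];
    exact: disk'.
- apply: surj; case: below' => [[d Cd dn']|dn'].
    by left; exists d => // q /dn'; exact: le_extW.
  by right => q; apply: le_extW (dn' q).
Qed.
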